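(* Fix an o-minimal expansion of $(\mathbb{R},0,1,+,\times,\le)$. Let $X,Z$ be definable sets and $p\ge1$. For $1\le i\le p+1$ let $\mathcal{Y}_i=(Y_{i,0}\supset\cdots\supset Y_{i,r_i})$ be closed definable subsets with $X\times Z^i=Y_{i,0}\supset Y_{i,1}\supset\cdots\supset Y_{i,r_i}$. Then there exists $C>0$, depending on $\mathcal{Y}_1,\ldots,\mathcal{Y}_{p+1}$, such that for all $n>0$ and $z=(z_0,\ldots,z_n)\in Z^{n+1}$ there exists a stratification of $X$ of length at most $C\cdot(n+1)^{(p+1)\dim X}$ which refines the stratifications of $X$ canonically associated to the filtrations $\mathcal{Y}_{i,z^{(J)}}=(Y_{i,0,z^{(J)}}\supset\cdots\supset Y_{i,r_i,z^{(J)}})$ for all $1\le i\le p$ and all ordered subsets $J\subset\{0,\ldots,n\}$ with $i$ elements.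
   Context: Topology is Euclidean; $\dim$ is o-minimal dimension. For $J=\{j_1,\ldots,j_i\}$, $z^{(J)}=(z_{j_1},\ldots,z_{j_i})$. For a definable $Y\subset X\times Z^i$ and $w\in Z^i$, $Y_w=\{x\in X\mid (x,w)\in Y\}$. A stratification of a definable set $X$ is a finite partition of $X$ into locally closed definable subsets; its length is the number of parts; refinement means each part of the coarser one is a union of parts of the finer one. The stratification associated to a filtration $X=X_0\supseteq X_1\supseteq\cdots\supseteq X_r$ by closed subsets has strata the nonempty sets among $X_j\setminus X_{j+1}$ ($0\le j<r$) and $X_r$. *)

(* Defs.v *)
From HB Require Import structures.
From mathcomp Require Import all_boot all_order all_algebra finmap.
From mathcomp Require Import all_classical all_reals topology normedtype.

Set Implicit Arguments.
Unset Strict Implicit.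
Unset Printing Implicit Defensive.

Import Order.TTheory GRing.Theory Num.Theory.
Import numFieldNormedType.Exports.

Local Open Scope classical_set_scope.
Local Open Scope ring_scope.

Definition rowinit (R : Type) (n : nat) (x : 'rV[R]_n.+1) : 'rV[R]_n :=
  col' ord_max x.

Definition rowtail (R : Type) (n : nat) (x : 'rV[R]_n.+1) : 'rV[R]_n :=
  col' ord0 x.

Definition rowlast (R : Type) (n : nat) (x : 'rV[R]_n.+1) : R := x 0 ord_max.

(* O-minimal expansions of the ordered field of real numbers, in van den Dries'
   formulation: definable R n is the collection of the subsets of R^n that are
   definable, with real parameters, in the expansion. By definable1, every
   singleton of R (in particular {0} and {1}) is definable. *)
Record ominStructure (R : realType) := OminStructure {
  definable : forall n : nat, set (set 'rV[R]_n);
  definable0 : forall n, @definable n set0;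
  definableU : forall n (A B : set 'rV[R]_n),
    definable A -> definable B -> definable (A `|` B);
  definableC : forall n (A : set 'rV[R]_n), definable A -> definable (~` A);
  definable_cylr : forall n (A : set 'rV[R]_n),
    definable A -> definable (@rowinit R n @^-1` A);
  definable_cyll : forall n (A : set 'rV[R]_n),
    definable A -> definable (@rowtail R n @^-1` A);
  definable_diag : forall n (i j : 'I_n),
    definable [set x : 'rV[R]_n | x 0 i = x 0 j];
  definable_proj : forall n (A : set 'rV[R]_n.+1),
    definable A -> definable (@rowinit R n @` A);
  definable_le : definable [set x : 'rV[R]_2 | x 0 0 <= x 0 1];
  definable_add : definable
    [set x : 'rV[R]_3 | x 0 (inord 0) + x 0 (inord 1) = x 0 (inord 2)];
  definable_mul : definable
    [set x : 'rV[R]_3 | x 0 (inord 0) * x 0 (inord 1) = x 0 (inord 2)];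
  definable1 : forall A : set 'rV[R]_1, definable A <->
    exists s : seq (interval R),
      A = [set x | exists2 I : interval R, I \in s & x 0 0 \in I]
}.

Section Omin.
Context {R : realType} (S : ominStructure R).

Definition graph_on (m : nat) (A : set 'rV[R]_m) (f : 'rV[R]_m -> R) :
  set 'rV[R]_m.+1 := [set x | A (rowinit x) /\ rowlast x = f (rowinit x)].

(* The set (f, g)_A *)
Definition band_on (m : nat) (A : set 'rV[R]_m) (f g : 'rV[R]_m -> \bar R) :
  set 'rV[R]_m.+1 :=
  [set x | A (rowinit x) /\
           (f (rowinit x) < (rowlast x)%:E < g (rowinit x))%E].

Definition cell_fun (m : nat) (A : set 'rV[R]_m) (f : 'rV[R]_m -> R) : Prop :=
  definable S (graph_on A f) /\ {within A, continuous f}.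

(* cell_fun together with the constant functions -oo and +oo *)
Definition cell_efun (m : nat) (A : set 'rV[R]_m) (f : 'rV[R]_m -> \bar R) :
  Prop :=
  [\/ f = cst -oo%E, f = cst +oo%E |
      exists2 g : 'rV[R]_m -> R, cell_fun A g & f = EFin \o g].

(* cell m d A: A is an (i_1, ..., i_m)-cell of R^m with i_1 + ... + i_m = d.
   The induction starts at R^0, so that points and nonempty open intervals are
   the graphs and bands over the unique point of R^0. *)
Inductive cell : forall m : nat, nat -> set 'rV[R]_m -> Prop :=
| cell_pt : @cell 0 0 setT
| cell_graph (m d : nat) (A : set 'rV[R]_m) (f : 'rV[R]_m -> R) :
    cell d A -> cell_fun A f -> cell d (graph_on A f)
| cell_band (m d : nat) (A : set 'rV[R]_m) (f g : 'rV[R]_m -> \bar R) :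
    cell d A -> cell_efun A f -> cell_efun A g ->
    (forall x, A x -> (f x < g x)%E) ->
    cell d.+1 (band_on A f g).

(* The largest dimension of a cell contained in X. Convention: the value on
   set0 is 0 (instead of -oo). *)
Definition odim (m : nat) (X : set 'rV[R]_m) : nat :=
  \max_(d < m.+1 | `[< exists2 A, cell d A & A `<=` X >]) d.

Definition closed_in (m : nat) (X A : set 'rV[R]_m) : Prop :=
  A `<=` X /\ closed (A : set (subspace X)).

Definition locally_closed_in (m : nat) (X A : set 'rV[R]_m) : Prop :=
  A `<=` X /\ exists U F : set (subspace X),
    [/\ open U, closed F & A = U `&` F].

(* The parts of a partition are nonempty. *)
Definition stratification (m : nat) (X : set 'rV[R]_m)
    (P : set (set 'rV[R]_m)) : Prop :=
  [/\ finite_set P, partition P id X &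
      forall A, P A -> definable S A /\ locally_closed_in X A].

Definition strat_length (m : nat) (P : set (set 'rV[R]_m)) : nat :=
  #|` fset_set P|.

Definition strat_refines (m : nat) (P Q : set (set 'rV[R]_m)) : Prop :=
  forall A, Q A ->
    exists2 D : set (set 'rV[R]_m), D `<=` P & A = \bigcup_(B in D) B.

Definition filtration_strata (m r : nat) (F : nat -> set 'rV[R]_m) :
  set (set 'rV[R]_m) :=
  [set A | A !=set0 /\
           ((exists2 j : nat, (j < r)%N & A = F j `\` F j.+1) \/ A = F r)].

(* A point w of (R^k)^i is an i x k matrix, whose rows are the components of
   w; the pair (x, w) is identified with a point of R^(m + i * k). *)
Definition pairpt (m i k : nat) (x : 'rV[R]_m) (w : 'M[R]_(i, k)) :
  'rV[R]_(m + i * k) := row_mx x (mxvec w).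

Definition setpow (k : nat) (Z : set 'rV[R]_k) (i : nat) : set 'M[R]_(i, k) :=
  [set w | forall j : 'I_i, Z (row j w)].

Definition prodpow (m k : nat) (X : set 'rV[R]_m) (Z : set 'rV[R]_k)
    (i : nat) : set 'rV[R]_(m + i * k) :=
  [set v | exists x w, [/\ X x, setpow Z w & v = pairpt x w]].

Definition fiber (m i k : nat) (X : set 'rV[R]_m)
    (Y : set 'rV[R]_(m + i * k)) (w : 'M[R]_(i, k)) : set 'rV[R]_m :=
  [set x | X x /\ Y (pairpt x w)].

End Omin.

Arguments prodpow {R m k} X Z i.

(* Main.v *)
(* Only the sets Y_{i,j} with i <= p matter, and the atoms of the Boolean algebra
   generated by their fibres already do the job: each atom is the trace on X of
   an intersection of an open and a closed set. The atoms are the types of the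
   points of X over the N = O((n+1)^p) parameters z^(J), and there are
   O(N^(dim X)) of them. Indeed, let t be the last coordinate of a point (x', t).
   The type of t over x' and the parameters is that of the nearest boundary point
   below t of a fibre, or of its right germ; this point is given by a single
   parameter b and by an index, which is bounded by uniform finiteness. Once b is
   fixed, the type of (x', t) is a type of x' over N parameters, so that t costs
   one factor N. If t is a boundary point of the fibre of X over x', then it is a
   function of x' and a bounded index, and costs nothing. The number of
   coordinates of the first kind is at most dim X, as X contains a cell of that
   dimension.

   The facts needed from o-minimality use that the real line is uncountable: an
   interval covered by countably many definable sets has a subinterval contained
   in one of them. By induction the same holds for cells. Applied to the sets
   defined with rational bounds, it shows that definable functions are
   continuous on a smaller cell of the same dimension, and that in a definable
   one-parameter family of finite subsets of the line the cardinality is locally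
   constant outside a finite set. That finite set is defined by a first-order
   formula, which reduces uniform finiteness for k+1 parameters to k parameters. *)
Require Import Defs.
From HB Require Import structures.
From mathcomp Require Import all_boot all_order all_algebra finmap.
From mathcomp Require Import all_classical all_reals topology normedtype.
From mathcomp Require Import lebesgue_measure.
From mathcomp Require Import zify lra.

Set Implicit Arguments.
Unset Strict Implicit.
Unset Printing Implicit Defensive.

Import Order.TTheory GRing.Theory Num.Theory.
Import numFieldNormedType.Exports.

Local Open Scope classical_set_scope.
Local Open Scope ring_scope.

(** * Environments: points of all dimensions as infinite sequences *)

Section Environments.
Context {R : realType}.

(** Infinite sequences serve as points of every [R^n], so that adding, dropping or permuting
    variables never changes a type; [supported] recovers the number of variables. *)
Definition env := nat -> R.

Definition scons (t : R) (e : env) : env := fun i => if i is j.+1 then e j else t.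
Definition stail (e : env) : env := fun i => e i.+1.
Definition sdrop (d : nat) (e : env) : env := fun i => e (d + i)%N.
Definition ssel (s : nat -> nat) (e : env) : env := fun i => e (s i).
Definition scat (d : nat) (x e : env) : env :=
  fun i => if (i < d)%N then x i else e (i - d)%N.

Lemma scons_stail e : scons (e 0%N) (stail e) = e.
Proof. by apply/funext; case. Qed.

Lemma scat0 x e : scat 0 x e = e.
Proof. by apply/funext => i; rewrite /scat ltn0 subn0. Qed.

Lemma scatS d x e : scat d.+1 x e = scons (x 0%N) (scat d (stail x) e).
Proof. by apply/funext; case. Qed.

Lemma scat_eqx d x y e : (forall i, (i < d)%N -> x i = y i) ->
  scat d x e = scat d y e.
Proof. by move=> xy; apply/funext => i; rewrite /scat; case: ltnP => // /xy. Qed.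

Lemma scat_lt d x e i : (i < d)%N -> scat d x e i = x i.
Proof. by rewrite /scat => ->. Qed.

Lemma sdrop_scat d x e : sdrop d (scat d x e) = e.
Proof.
by apply/funext => i; rewrite /scat /sdrop ltnNge leq_addr /= addKn.
Qed.

(* Coordinates are reversed, so that the last coordinate of a row is the head
   of its environment; entries beyond n are 0. *)
Definition env_of n (x : 'rV[R]_n) : env :=
  fun i => if insub i is Some j then x 0 (@rev_ord n j) else 0.

Definition row_of n (e : env) : 'rV[R]_n := \row_j e (rev_ord j).

Lemma env_of_ord n (x : 'rV[R]_n) (j : 'I_n) : env_of x j = x 0 (rev_ord j).
Proof. by rewrite /env_of valK. Qed.

Lemma env_of_out n (x : 'rV[R]_n) i : (n <= i)%N -> env_of x i = 0.
Proof. by move=> ni; rewrite /env_of insubF // ltnNge ni. Qed.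

Lemma env_ofK n (x : 'rV[R]_n) : row_of n (env_of x) = x.
Proof. by apply/rowP => j; rewrite mxE env_of_ord rev_ordK. Qed.

Lemma row_ofK n (e : env) i : (i < n)%N -> env_of (row_of n e) i = e i.
Proof.
move=> lt_in; rewrite -[i]/(nat_of_ord (Ordinal lt_in)) env_of_ord mxE.
by rewrite rev_ordK.
Qed.

Lemma stail_env_of n (x : 'rV[R]_n.+1) : stail (env_of x) = env_of (rowinit x).
Proof.
apply/funext => i; rewrite /stail; have [lt_in|ni] := ltnP i n; last first.
  by rewrite !env_of_out.
rewrite -[i.+1]/(nat_of_ord (@Ordinal n.+1 i.+1 lt_in)) env_of_ord.
rewrite -[i]/(nat_of_ord (Ordinal lt_in)) env_of_ord mxE; congr (x _ _).
by apply/val_inj; rewrite /= /bump; lia.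
Qed.

Lemma env_of0 n (x : 'rV[R]_n.+1) : env_of x 0%N = rowlast x.
Proof.
rewrite -[0%N]/(nat_of_ord (@ord0 n)) env_of_ord; congr (x _ _).
by apply/val_inj; rewrite /= subn1.
Qed.

Lemma env_of_rowlast n (x : 'rV[R]_n.+1) :
  env_of x = scons (rowlast x) (env_of (rowinit x)).
Proof. by rewrite -env_of0 -stail_env_of scons_stail. Qed.

Lemma env_of_rowtail n (x : 'rV[R]_n.+1) i : (i < n)%N ->
  env_of (rowtail x) i = env_of x i.
Proof.
move=> lt_in; rewrite -[i in LHS]/(nat_of_ord (Ordinal lt_in)) env_of_ord mxE.
rewrite -[i]/(nat_of_ord (@Ordinal n.+1 i (leqW lt_in))) env_of_ord.
by congr (x _ _); apply/val_inj; rewrite /= /bump; lia.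
Qed.

Lemma rowinit_row_of n (e : env) t : rowinit (row_of n.+1 (scons t e)) = row_of n e.
Proof.
apply/rowP => j; rewrite !mxE /=.
have -> : (n.+1 - (bump n j).+1)%N = (n - j.+1).+1 by move: (ltn_ord j); rewrite /bump; lia.
by [].
Qed.

Definition supported (n : nat) (P : env -> Prop) : Prop :=
  forall e e', (forall i, (i < n)%N -> e i = e' i) -> P e -> P e'.

Lemma supported_eq n P e e' : supported n P ->
  (forall i, (i < n)%N -> e i = e' i) -> P e = P e'.
Proof.
by move=> sP ee'; apply/propext; split; apply: sP => // i /ee'.
Qed.

Lemma supported_leq m n P : (m <= n)%N -> supported m P -> supported n P.
Proof. by move=> mn sP e e' ee'; apply: sP => i im; apply/ee'/(leq_trans im). Qed.

(** These are the substitutions allowed in formulas: variables for variables. Sums are not terms;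
    they enter through the ternary relation [u + v = w]. *)
Definition reindexing (F : env -> env) :=
  exists s : nat -> nat, forall e i, F e i = e (s i).

Definition coordinate (v : env -> R) := exists i : nat, forall e, v e = e i.

Lemma reindexing_id : reindexing (fun e => e).
Proof. by exists id. Qed.

Lemma reindexing_stail F : reindexing F -> reindexing (fun e => stail (F e)).
Proof. by move=> [s sE]; exists (fun i => s i.+1) => e i; rewrite /stail sE. Qed.

Lemma reindexing_sdrop d F : reindexing F -> reindexing (fun e => sdrop d (F e)).
Proof. by move=> [s sE]; exists (fun i => s (d + i)%N) => e i; rewrite /sdrop sE. Qed.

Lemma reindexing_scons v F : coordinate v -> reindexing F ->
  reindexing (fun e => scons (v e) (F e)).
Proof.
move=> [i vE] [s sE]; exists (fun j => if j is k.+1 then s k else i) => e [|j] /=.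
- exact: vE.
- exact: sE.
Qed.

Lemma reindexing_scat d F G : reindexing F -> reindexing G ->
  reindexing (fun e => scat d (F e) (G e)).
Proof.
move=> [s sE] [s' sE']; exists (fun i => if (i < d)%N then s i else s' (i - d)%N).
by move=> e i; rewrite /scat; case: ifP => _; rewrite ?sE ?sE'.
Qed.

Lemma reindexing_sel F (s : nat -> nat) : reindexing F ->
  reindexing (fun e => ssel s (F e)).
Proof. by move=> [s' sE]; exists (fun i => s' (s i)) => e i; rewrite /ssel sE. Qed.

Lemma coordinate_sel F i : reindexing F -> coordinate (fun e => F e i).
Proof. by move=> [s sE]; exists (s i) => e; rewrite sE. Qed.

End Environments.
Arguments env : clear implicits.

Ltac solve_reindexing :=
  cbv beta;
  lazymatch goal with
  | |- reindexing (fun e => e) => exact: reindexing_id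
  | |- reindexing (stail) => exact: (reindexing_stail reindexing_id)
  | |- reindexing (sdrop ?d) => exact: (reindexing_sdrop d reindexing_id)
  | |- reindexing (fun e => stail (@?F e)) =>
      apply: (@reindexing_stail _ F); solve_reindexing
  | |- reindexing (fun e => sdrop ?d (@?F e)) =>
      apply: (@reindexing_sdrop _ d F); solve_reindexing
  | |- reindexing (fun e => scons (@?v e) (@?F e)) =>
      apply: (@reindexing_scons _ v F); solve_reindexing
  | |- reindexing (fun e => scat ?d (@?F e) (@?G e)) =>
      apply: (@reindexing_scat _ d F G); solve_reindexing
  | |- reindexing (fun e => ssel ?s (@?F e)) =>
      apply: (@reindexing_sel _ F s); solve_reindexing
  | |- reindexing (ssel ?s) => exact: (reindexing_sel s reindexing_id)
  | |- coordinate _ => eapply coordinate_sel; solve_reindexing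
  end.

(** * First-order formulas define definable sets *)

Section DefinablePredicates.
Context {R : realType} (S : ominStructure R).
Local Notation env := (env R).
Implicit Types P Q : env -> Prop.

Definition defined_at n P := definable S [set x : 'rV[R]_n | P (env_of x)].

(** The arity is existentially quantified so that formulas with different free variables combine
    without bookkeeping; by [defpred_at] every support can play the part of [n]. *)
Definition defpred P := exists2 n, supported n P & defined_at n P.

Lemma defined_at_ext n P Q : (forall e, P e <-> Q e) -> defined_at n P -> defined_at n Q.
Proof. by move=> PQ; have -> : P = Q by apply/funext => e; apply/propext. Qed.

Lemma defpred_ext P Q : (forall e, P e <-> Q e) -> defpred P -> defpred Q.
Proof. by move=> PQ; have -> : P = Q by apply/funext => e; apply/propext. Qed.

(** Since coordinates are reversed, a cylinder with a new first row coordinate adds a new last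
    variable to the environment. *)
Lemma defined_atS n P : supported n P -> defined_at n P -> defined_at n.+1 P.
Proof.
move=> sP dP; have := definable_cyll dP; rewrite /defined_at.
congr (definable S _); apply/funext => x; apply: (supported_eq sP) => i.
exact: env_of_rowtail.
Qed.

Lemma defined_at_leq m n P : (m <= n)%N -> supported m P -> defined_at m P ->
  defined_at n P.
Proof.
move=> /subnKC <- sP dP; elim: (n - m)%N => [|k IH]; first by rewrite addn0.
by rewrite addnS; apply: defined_atS => //; apply: supported_leq sP; lia.
Qed.

Lemma defined_at_true n : defined_at n (fun=> True).
Proof.
rewrite /defined_at -(setCK [set _ | True]); apply: definableC.
have -> : ~` [set _ : 'rV[R]_n | True] = set0 by apply/seteqP; split=> x //= /(_ I).
exact: definable0.
Qed.

Lemma defined_at_not n P : defined_at n P -> defined_at n (fun e => ~ P e).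
Proof. exact: definableC. Qed.

Lemma defined_at_or n P Q : defined_at n P -> defined_at n Q ->
  defined_at n (fun e => P e \/ Q e).
Proof. exact: definableU. Qed.

Lemma defined_at_and n P Q : defined_at n P -> defined_at n Q ->
  defined_at n (fun e => P e /\ Q e).
Proof.
move=> dP dQ; apply: (@defined_at_ext n (fun e => ~ (~ P e \/ ~ Q e))).
  by move=> e; rewrite not_orE !notK.
by apply: defined_at_not; apply: defined_at_or; apply: defined_at_not.
Qed.

Lemma defined_at_all_lt n m (P : nat -> env -> Prop) :
  (forall i, (i < m)%N -> defined_at n (P i)) ->
  defined_at n (fun e => forall i, (i < m)%N -> P i e).
Proof.
elim: m => [|m IH] dP; first by apply: defined_at_ext (defined_at_true n).
have dPm : defined_at n (fun e => (forall i, (i < m)%N -> P i e) /\ P m e).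
  by apply: defined_at_and; [apply: IH => i im; apply: dP; lia|apply: dP].
apply: defined_at_ext dPm => e; split=> [[PI Pm] i|PI].
  by rewrite ltnS leq_eqVlt => /orP[/eqP-> //|/PI].
by split=> [i im|]; apply: PI => //; lia.
Qed.

Lemma defined_at_ex n P : defined_at n.+1 P ->
  defined_at n (fun e => exists t, P (scons t e)).
Proof.
move=> dP; have := definable_proj dP; rewrite /defined_at.
congr (definable S _); apply/seteqP; split=> [_ [x Px <-]|y [t Pt]] /=.
  by exists (rowlast x); rewrite -env_of_rowlast.
exists (row_of n.+1 (scons t (env_of y))); last by rewrite rowinit_row_of env_ofK.
by rewrite /= env_of_rowlast rowinit_row_of env_ofK -env_of0 row_ofK.
Qed.

Lemma defined_at_exn d n P : defined_at (d + n) P ->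
  defined_at n (fun e => exists y, P (scat d y e)).
Proof.
elim: d P => [|d IH] P dP.
  by apply: defined_at_ext dP => e; split=> [Pe|[y]]; [exists e|]; rewrite scat0.
apply: defined_at_ext (IH _ (defined_at_ex dP)) => e; split=> [[y [t Pt]]|[y Py]].
  by exists (scons t y); rewrite scatS.
by exists (stail y), (y 0%N); rewrite -scatS.
Qed.

Lemma defined_at_eq n i j : (i < n)%N -> (j < n)%N ->
  defined_at n (fun e => e i = e j).
Proof.
move=> lt_in lt_jn.
have := definable_diag S (rev_ord (Ordinal lt_in)) (rev_ord (Ordinal lt_jn)).
congr (definable S _); apply/funext => x /=.
by rewrite -(env_of_ord x (Ordinal lt_in)) -(env_of_ord x (Ordinal lt_jn)).
Qed.

(** Substitution is obtained from the axioms by adjoining [m] fresh variables in front, equating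
    them with the selected ones through diagonals, and projecting them away. *)
Lemma defined_at_reindex m n P (s : nat -> nat) : supported m P -> defined_at m P ->
  (forall i, (i < m)%N -> (s i < n)%N) ->
  defined_at n (fun e => P (fun i => e (s i))).
Proof.
move=> sP dP sn.
have dQ : defined_at (m + n)
    (fun u => P u /\ forall i, (i < m)%N -> u i = u (m + s i)%N).
  apply: defined_at_and; first by apply: defined_at_leq dP; rewrite ?leq_addr.
  apply: defined_at_all_lt => i im.
  by apply: defined_at_eq; rewrite ?ltn_add2l ?sn // ltn_addr.
apply: defined_at_ext (defined_at_exn dQ) => e; split=> [[y [Py yE]]|Pe].
  apply: sP Py => i im.
  by rewrite yE // /scat ltnNge leq_addr /= addKn.
exists (fun i => e (s i)); split=> [|i im].
  by apply: sP Pe => i im; rewrite scat_lt.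
by rewrite scat_lt // /scat ltnNge leq_addr /= addKn.
Qed.

(* The coordinates beyond the support are moved to the front, where they can be
   projected away. *)
Lemma defpred_at n P : defpred P -> supported n P -> defined_at n P.
Proof.
move=> [k sPk dPk] sP; have [kn|/ltnW nk] := leqP k n.
  exact: defined_at_leq dPk.
have [k0|k0] := posnP k.
  by move: nk dPk; rewrite k0 leqn0 => /eqP ->.
(* Indices from [n] on are invisible to [P] and may be sent to any index below [k]; index 0 is
   available because [k] is now positive. *)
pose s i := if (i < n)%N then (k - n + i)%N else 0%N.
have sk i : (i < k)%N -> (s i < k)%N by rewrite /s; case: ifP; lia.
have := defined_at_reindex sPk dPk sk; rewrite -{1}(subnK nk) => /defined_at_exn.
apply: defined_at_ext => e; split=> [[y]|Pe]; last exists e.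
  apply: sP => i lt_in; rewrite /s lt_in /scat ifF; last by lia.
  by rewrite addKn.
apply: sP Pe => i lt_in; rewrite /s lt_in /scat ifF; last by lia.
by rewrite addKn.
Qed.

Lemma supported_row_of n (A : set 'rV[R]_n) : supported n (fun e => A (row_of n e)).
Proof.
move=> e e' ee' Ae; have <- // : row_of n e = row_of n e'.
by apply/rowP => j; rewrite !mxE ee' // ltn_ord.
Qed.

Lemma defpred_row_of n (A : set 'rV[R]_n) : definable S A ->
  defpred (fun e => A (row_of n e)).
Proof.
move=> dA; exists n; first exact: supported_row_of.
by rewrite /defined_at; under eq_set => x do rewrite env_ofK.
Qed.

Lemma supported_fun n m P (F : env -> env) : supported m P ->
  (forall e e', (forall i, (i < n)%N -> e i = e' i) -> forall i, (i < m)%N -> F e i = F e' i) ->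
  supported n (fun e => P (F e)).
Proof. by move=> sP FE e e' /FE ee'; apply: sP. Qed.

Lemma defpred_reindex P F : defpred P -> reindexing F -> defpred (fun e => P (F e)).
Proof.
move=> [m sP dP] [s sE]; pose n := (\max_(i < m) s i).+1.
have sn i : (i < m)%N -> (s i < n)%N.
  by move=> im; rewrite ltnS (leq_bigmax (Ordinal im)).
exists n; last first.
  apply: defined_at_ext (defined_at_reindex sP dP sn) => e.
  by have -> : F e = (fun i => e (s i)) by apply/funext.
by apply: supported_fun sP _ => e e' ee' i im; rewrite !sE ee' // sn.
Qed.

Lemma defpred_true : defpred (fun=> True).
Proof. by exists 0%N => //; exact: defined_at_true. Qed.

Lemma defpred_not P : defpred P -> defpred (fun e => ~ P e).
Proof.
move=> [n sP dP]; exists n; last exact: defined_at_not.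
by move=> e e' ee'; rewrite (supported_eq sP ee').
Qed.

Lemma defpred_and P Q : defpred P -> defpred Q -> defpred (fun e => P e /\ Q e).
Proof.
move=> [m sP dP] [n sQ dQ]; have [mn nn] := (leq_maxl m n, leq_maxr m n).
exists (maxn m n); last first.
  by apply: defined_at_and; [exact: defined_at_leq dP|exact: defined_at_leq dQ].
move=> e e' ee'; rewrite (supported_eq (supported_leq mn sP) ee').
by rewrite (supported_eq (supported_leq nn sQ) ee').
Qed.

Lemma defpred_andb (a b : env -> bool) : defpred a -> defpred b ->
  defpred (fun e => a e && b e).
Proof.
move=> da db; apply: (@defpred_ext (fun e => a e /\ b e)); last exact: defpred_and.
by move=> e; split=> /andP.
Qed.

Lemma defpred_or P Q : defpred P -> defpred Q -> defpred (fun e => P e \/ Q e).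
Proof.
move=> dP dQ; apply: (@defpred_ext (fun e => ~ (~ P e /\ ~ Q e))).
  by move=> e; rewrite not_andE !notK.
by apply: defpred_not; apply: defpred_and; apply: defpred_not.
Qed.

Lemma defpred_imp P Q : defpred P -> defpred Q -> defpred (fun e => P e -> Q e).
Proof.
move=> dP dQ; apply: (@defpred_ext (fun e => ~ P e \/ Q e)).
  by move=> e; rewrite implyE.
by apply: defpred_or => //; apply: defpred_not.
Qed.

Lemma defpred_iff P Q : defpred P -> defpred Q -> defpred (fun e => P e <-> Q e).
Proof. by move=> dP dQ; apply: defpred_and; apply: defpred_imp. Qed.

Lemma defpred_ex (P : env -> R -> Prop) : defpred (fun e => P (stail e) (e 0%N)) ->
  defpred (fun e => exists t, P e t).
Proof.
move=> [n sP dP]; exists n.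
  move=> e e' ee' [t Pt]; exists t.
  by apply: (sP (scons t e) (scons t e') _ Pt); case=> // i /ltnW /ee'.
exact: defined_at_ex (defined_at_leq (leqnSn n) sP dP).
Qed.

Lemma defpred_all (P : env -> R -> Prop) : defpred (fun e => P (stail e) (e 0%N)) ->
  defpred (fun e => forall t, P e t).
Proof.
move=> dP; apply: (@defpred_ext (fun e => ~ exists t, ~ P e t)).
  by move=> e; rewrite -forallNE; split=> PI t; [exact: contrapT (PI t)|apply].
by apply: defpred_not; apply: defpred_ex; apply: defpred_not.
Qed.

Lemma defpred_ex_scat d P : defpred P -> defpred (fun e => exists x, P (scat d x e)).
Proof.
move=> dP; elim: d P dP => [|d IH] P dP.
  by apply: defpred_ext dP => e; split=> [Pe|[y]]; [exists e|]; rewrite scat0.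
have {}/IH : defpred (fun e => exists t, P (scons t e)).
  by apply: defpred_ex; apply: defpred_ext dP => e; rewrite scons_stail.
apply: defpred_ext => e; split=> [[y [t Pt]]|[y Py]].
  by exists (scons t y); rewrite scatS.
by exists (stail y), (y 0%N); rewrite -scatS.
Qed.

(** A quantifier over whole environments is first-order here because only the first [d] entries of
    the bound environment matter. *)
Lemma defpred_exn d (P : env -> env -> Prop) :
  (forall x y e, (forall i, (i < d)%N -> x i = y i) -> P e x -> P e y) ->
  defpred (fun e => P (sdrop d e) e) -> defpred (fun e => exists x, P e x).
Proof.
move=> Pext dP; apply: (@defpred_ext (fun e => exists x, P e (scat d x e))).
  move=> e; split=> [[x Px]|[x Px]]; first by eexists; exact: Px.
  by exists x; apply: Pext Px => i id; rewrite scat_lt.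
suff : defpred (fun e => exists x, P (sdrop d (scat d x e)) (scat d x e)).
  by apply: defpred_ext => e; split=> -[x]; rewrite ?sdrop_scat => Px; exists x;
    rewrite ?sdrop_scat.
exact: defpred_ex_scat dP.
Qed.

Lemma defpred_alln d (P : env -> env -> Prop) :
  (forall x y e, (forall i, (i < d)%N -> x i = y i) -> P e x -> P e y) ->
  defpred (fun e => P (sdrop d e) e) -> defpred (fun e => forall x, P e x).
Proof.
move=> Pext dP; apply: (@defpred_ext (fun e => ~ exists t, ~ P e t)).
  by move=> e; rewrite -forallNE; split=> PI t; [exact: contrapT (PI t)|apply].
apply: defpred_not; apply: (@defpred_exn d); last exact: defpred_not.
move=> x y e xy nPx Py; apply: nPx; apply: Pext Py => i /xy //.
Qed.

Lemma defpred_all_lt n (P : nat -> env -> Prop) :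
  (forall i, defpred (P i)) -> defpred (fun e => forall i, (i < n)%N -> P i e).
Proof.
move=> dP; elim: n => [|n IH]; first by apply: defpred_ext defpred_true.
apply: (@defpred_ext (fun e => (forall i, (i < n)%N -> P i e) /\ P n e)); last first.
  exact: defpred_and.
move=> e; split=> [[PI Pm] i|PI].
  by rewrite ltnS leq_eqVlt => /orP[/eqP-> //|/PI].
by split=> [i im|]; apply: PI => //; lia.
Qed.

Lemma defpred_ex_seq (T : eqType) (s : seq T) (P : T -> env -> Prop) :
  (forall a, a \in s -> defpred (P a)) -> defpred (fun e => exists2 a, a \in s & P a e).
Proof.
elim: s => [|a s IH] dP.
  by apply: defpred_ext (defpred_not defpred_true) => e; split=> [/(_ I)|[]].
apply: (@defpred_ext (fun e => P a e \/ exists2 a, a \in s & P a e)).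
  move=> e; split=> [[Pa|[b bs Pb]]|[b]].
  - by exists a; rewrite ?mem_head.
  - by exists b; rewrite // in_cons bs orbT.
  - by rewrite in_cons => /predU1P[->|bs Pb]; [left|right; exists b].
apply: defpred_or; first by apply: dP; rewrite mem_head.
by apply: IH => b bs; apply: dP; rewrite in_cons bs orbT.
Qed.

Lemma defpred_atom n (A : set 'rV[R]_n) (v : 'I_n -> env -> R) : definable S A ->
  (forall i, coordinate (v i)) -> defpred (fun e => A (\row_i v i e)).
Proof.
move=> dA cv; have [s sE] := choice cv.
pose s' i := if insub i is Some j then s (@rev_ord n j) else 0%N.
have := defpred_reindex (defpred_row_of dA) (F := fun e i => e (s' i)).
have rF : reindexing (fun (e : env) i => e (s' i)) by exists s'.
move=> /(_ rF); apply: defpred_ext => e; rewrite (_ : row_of _ _ = \row_i v i e) //.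
by apply/rowP => j; rewrite !mxE /s' valK rev_ordK sE.
Qed.

Lemma defpred_le v w : coordinate v -> coordinate w -> defpred (fun e => v e <= w e).
Proof.
move=> cv cw; pose c (i : 'I_2) := if i == 0 then v else w.
have := defpred_atom (v := c) (definable_le S); rewrite /c => /(_ _)/wrap[].
  by move=> i; case: ifP.
by apply: defpred_ext => e /=; rewrite !mxE.
Qed.

Lemma defpred_eq v w : coordinate v -> coordinate w -> defpred (fun e => v e = w e).
Proof.
move=> cv cw; apply: (@defpred_ext (fun e => v e <= w e /\ w e <= v e)).
  by move=> e; split=> [[vw wv]|->] //; apply/eqP; rewrite eq_le vw.
by apply: defpred_and; apply: defpred_le.
Qed.

Lemma defpred_lt v w : coordinate v -> coordinate w -> defpred (fun e => v e < w e).
Proof.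
move=> cv cw; apply: (@defpred_ext (fun e => ~ (w e <= v e))).
  by move=> e; rewrite ltNge; split=> [/negP|/negP].
by apply: defpred_not; apply: defpred_le.
Qed.

Lemma defpred_add u v w : coordinate u -> coordinate v -> coordinate w ->
  defpred (fun e => u e + v e = w e).
Proof.
move=> cu cv cw; pose c (i : 'I_3) := if i == inord 0 then u else if i == inord 1 then v else w.
have := defpred_atom (v := c) (definable_add S); rewrite /c => /(_ _)/wrap[].
  by move=> i; do 2?case: ifP.
apply: defpred_ext => e /=; rewrite !mxE !eqxx.
by rewrite -!(inj_eq val_inj) /= !inordK.
Qed.

Lemma defpred_const c : defpred (fun e => e 0%N = c).
Proof.
have dA : definable S [set x : 'rV[R]_1 | x 0 0 = c].
  apply/(definable1 S); exists [:: `[c, c]%R]; apply/seteqP; split=> x /=.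
    by move=> <-; exists `[x 0 0, x 0 0]; rewrite ?mem_head // in_itv /= lexx.
  by case=> I; rewrite inE => /eqP ->; rewrite in_itv /= -eq_le => /eqP.
have := defpred_atom (v := fun _ e => e 0%N) dA; move=> /(_ (fun=> ex_intro _ 0%N (fun=> erefl))).
by apply: defpred_ext => e /=; rewrite mxE.
Qed.

Lemma defpred_eqc v c : coordinate v -> defpred (fun e => v e = c).
Proof.
move=> [i vE]; have /(defpred_reindex (defpred_const c)) : reindexing (fun e : env => fun=> e i).
  by exists (fun=> i).
by apply: defpred_ext => e; rewrite vE.
Qed.

(** Real parameters are allowed, and a formula sees only finitely many entries of [c]; these are
    reintroduced as bound variables [y] equal to constants. *)
Lemma defpred_fix P d c : defpred P -> defpred (fun e => P (scat d e c)).
Proof.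
move=> [n sP dP].
apply: (@defpred_ext (fun e => exists y, (forall i, (i < n)%N -> y i = c i) /\ P (scat d e y))).
  move=> e; split=> [[y [yc]]|Pe]; last by exists c.
  by apply: sP => i lt_in; rewrite /scat; case: ifP => // _; apply: yc; lia.
apply: (@defpred_exn n).
  move=> x y e xy [xc Px]; split=> [i lt_in|]; first by rewrite -xy ?xc.
  by apply: sP Px => i lt_in; rewrite /scat; case: ifP => // _; apply: xy; lia.
apply: defpred_and.
  by apply: defpred_all_lt => i; apply: defpred_eqc; exists i.
have dP' : defpred P by exists n.
by apply: (defpred_reindex dP'); solve_reindexing.
Qed.
End DefinablePredicates.

(** Follows the syntax of the formula; a quantifier binds entry 0 of the environment. Subformulas
    that it does not recognize are left as goals. *)
Ltac solve_defpred :=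
  cbv beta;
  lazymatch goal with
  | H : defpred ?S ?P |- defpred ?S ?P => exact: H
  | H : defpred ?S ?P |- defpred ?S (fun e => ?P (@?F e)) =>
      apply: (@defpred_reindex _ _ P F H); solve_reindexing
  | |- defpred _ (fun=> True) => exact: defpred_true
  | |- defpred _ (fun e => exists t : Real.sort _, @?P e t) =>
      apply: (@defpred_ex _ _ P); solve_defpred
  | |- defpred _ (fun e => forall t : Real.sort _, @?P e t) =>
      apply: (@defpred_all _ _ P); solve_defpred
  | |- defpred _ (fun e => @?P e /\ @?Q e) =>
      apply: (@defpred_and _ _ P Q); solve_defpred
  | |- defpred _ (fun e => is_true (@?P e && @?Q e)) =>
      apply: (@defpred_andb _ _ P Q); solve_defpred
  | |- defpred _ (fun e => @?P e \/ @?Q e) =>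
      apply: (@defpred_or _ _ P Q); solve_defpred
  | |- defpred _ (fun e => @?P e <-> @?Q e) =>
      apply: (@defpred_iff _ _ P Q); solve_defpred
  | |- defpred _ (fun e => ~ @?P e) =>
      apply: (@defpred_not _ _ P); solve_defpred
  | |- defpred _ (fun e => is_true (@?v e <= @?w e)) =>
      apply: (@defpred_le _ _ v w); solve_reindexing
  | |- defpred _ (fun e => is_true (@?v e < @?w e)) =>
      apply: (@defpred_lt _ _ v w); solve_reindexing
  | |- defpred _ (fun e => @?u e + @?v e = @?w e) =>
      apply: (@defpred_add _ _ u v w); solve_reindexing
  | |- defpred _ (fun e => @?v e = @?w e) =>
      first [apply: (@defpred_eq _ _ v w); solve_reindexing |
             apply: defpred_eqc; solve_reindexing]
  | |- defpred _ (fun e => @?P e -> @?Q e) =>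
      apply: (@defpred_imp _ _ P Q); solve_defpred
  | |- _ => idtac
  end.

(** * Definable subsets of the line: countable covers and boundaries *)

Section DefinableSubsetsOfTheLine.
Context {R : realType} (S : ominStructure R).
Local Notation env := (env R).
Implicit Types (P : env -> Prop) (T : set R).

(** A countable union of finite sets is countable, hence of Lebesgue measure 0, whereas the interval
    has measure [b - a]. *)
Lemma uncountable_itv (I : countType) (T : I -> set R) (a b : R) : a < b ->
  (forall t, a < t < b -> exists i, T i t) -> exists i, infinite_set (T i).
Proof.
move=> ab cov; apply: contrapT => /forallNP fin.
have cT : countable (\bigcup_(i in [set: I]) T i).
  apply: bigcup_countable => // i _.
  by apply: finite_set_countable; apply: contrapT; exact: fin.
have cI : countable `]a, b[%classic.
  by apply: sub_countable cT; apply: subset_card_le => t /=; rewrite in_itv /= =>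
    /cov[i Ti]; exists i.
have := countable_lebesgue_measure0 cI.
by rewrite lebesgue_measure_itv /= lte_fin ab => /eqP; rewrite -EFinD eqe subr_eq0 gt_eqF.
Qed.

Definition defline T := defpred S (fun e => T (e 0%N)).

Lemma defpred_line P c : defpred S P -> defline (fun t => P (scons t c)).
Proof.
move=> /(defpred_fix 1 c); apply: defpred_ext => e.
by rewrite scatS scat0.
Qed.

(* A set containing no open interval meets each of the intervals composing it
   in at most one point. *)
Lemma defline_finite T : defline T ->
  (forall a b, a < b -> exists2 t, a < t < b & ~ T t) -> finite_set T.
Proof.
move=> dT noitv; have /(defpred_at dT) : supported 1 (fun e : env => T (e 0%N)).
  by move=> e e' ->.
move=> /(definable1 S)[s sE].
have TE t : T t <-> exists2 I : interval R, I \in s & t \in I.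
  have /(congr1 (fun A : set _ => A (\row__ t))) := sE.
  by rewrite /= env_of0 /rowlast !mxE => ->.
have : forall I, exists u, I \in s -> forall t, t \in I -> t = u.
  move=> I; have [[t tI]|none] := pselect (exists t, t \in I); last first.
    by exists 0 => _ t tI; case: none; exists t.
  exists t => Is u uI; apply: contrapT => /eqP; rewrite neq_lt => tu.
  wlog {tu} tu : t u tI uI / t < u.
    by move=> W; case/orP: tu => tu; [apply: (W u t)|apply: (W t u)].
  have [v /andP[tv vu] []] := noitv _ _ tu.
  apply/TE; exists I => //; apply: (@interval_is_interval _ I t u) => //.
  by rewrite !ltW.
move=> /choice[f fP]; apply: (@sub_finite_set _ _ [set` map f s]).
  by move=> t /TE[I Is tI]; apply/mapP; exists I => //; exact: fP.
exact: finite_seq.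
Qed.

(** One of the sets is infinite inside the interval, so by [defline_finite] it contains an interval
    there. The bounds are taken rational so that they can join the countable index set of a later
    cover. *)
Lemma itv_cover (I : countType) (T : I -> set R) (a b : R) :
  (forall i, defline (T i)) -> a < b ->
  (forall t, a < t < b -> exists i, T i t) ->
  exists i (q q' : rat), [/\ a < ratr q, ratr q < ratr q' :> R, ratr q' < b &
    forall t, ratr q < t < ratr q' -> T i t].
Proof.
move=> dT ab cov.
have [i inf] := @uncountable_itv I (fun i t => a < t < b /\ T i t) _ _ ab
  (fun t tab => let: ex_intro i Ti := cov t tab in ex_intro _ i (conj tab Ti)).
apply: contrapT => noq; apply: inf; apply: defline_finite.
  have dTi : defpred S (fun e => T i (e 0%N)) := dT i.
  apply: (@defpred_ext _ _ (fun e =>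
      (exists x y : R, x = a /\ y = b /\ x < e 0%N < y) /\ T i (e 0%N))).
    by move=> e; split=> [[[x [y [-> [-> ?]]]]]|[? ?]]; split=> //; exists a, b.
  by apply: defpred_and => //; solve_defpred.
move=> c d cd; apply: contrapT => noc.
have {}noc t : c < t < d -> a < t < b /\ T i t.
  by move=> tcd; apply: contrapT => nt; apply: noc; exists t.
have [q] := rat_in_itvoo cd; rewrite in_itv /= => /andP[cq qd].
have [q'] := rat_in_itvoo qd; rewrite in_itv /= => /andP[qq' q'd].
apply: noq; exists i, q, q'; split=> //.
- by have [|/andP[]] := noc (ratr q); rewrite ?cq.
- by have [|/andP[]] := noc (ratr q'); rewrite ?q'd ?(lt_trans cq).
- by move=> t /andP[qt tq']; apply: (noc t _).2; rewrite (lt_trans cq qt) (lt_trans tq').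
Qed.

Definition boundary T t := forall a b : R, a < t < b ->
  (exists u : R, a < u < b /\ T u) /\ (exists u : R, a < u < b /\ ~ T u).

(** An infinite boundary would contain an interval. Covering it by [T] and its complement gives a
    subinterval inside one of them, and the midpoint of that subinterval is no boundary point. *)
Lemma boundary_finite T : defline T -> finite_set (boundary T).
Proof.
move=> dT; have dT' : defpred S (fun e => T (e 0%N)) := dT.
apply: defline_finite.
  rewrite /defline /boundary.
  have dT2 (v : env -> R) : coordinate v -> defpred S (fun e => T (v e)).
    move=> [i vE]; have := @defpred_reindex _ S _ (ssel (fun=> i)) dT'.
    move=> /(_ (reindexing_sel _ reindexing_id)); apply: defpred_ext => e.
    by rewrite vE.
  solve_defpred; apply: dT2; solve_reindexing.
move=> a b ab; apply: contrapT => allbd.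
have {}allbd t : a < t < b -> boundary T t.
  by move=> tab; apply: contrapT => nt; apply: allbd; exists t.
have [||i [q [q' [aq qq' q'b Tq]]]] :=
    @itv_cover bool (fun i t => if i then T t else ~ T t) a b _ ab.
- by case=> //; apply: defpred_not.
- by move=> t _; case: (pselect (T t)); [exists true|exists false].
have [m qmq] : exists m : R, ratr q < m < ratr q'.
  by exists ((ratr q + ratr q') / 2); rewrite !midf_lt.
have mab : a < m < b.
  by case/andP: qmq => qm mq'; rewrite (lt_trans aq) // (lt_trans mq').
have [[u [uq Tu]] [v [vq nTv]]] := allbd m mab _ _ qmq.
by case: i Tq => Tq; [apply: nTv; exact: Tq|apply: (Tq u)].
Qed.

Lemma boundaryPn T t : ~ boundary T t ->
  exists c d, c < t < d /\ forall u, c < u < d -> T u <-> T t.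
Proof.
move=> nobd; apply: contrapT => noloc; apply: nobd => c d tcd.
split; apply: contrapT => /forallNP none; apply: noloc; exists c, d; split=> // u ucd.
  by split=> [Tu|Tt]; [case: (none u)|case: (none t)].
by split=> ?; apply: contrapT => ?; [case: (none t)|case: (none u)].
Qed.

(** Connectedness of the segment: [E] collects the ends of the initial segments on which [T] keeps
    its value at [a], and local constancy around [sup E] extends [E] beyond it until [b] is
    reached. *)
Lemma boundary_free_const T a b : a <= b ->
  (forall t, a <= t <= b -> ~ boundary T t) -> T a <-> T b.
Proof.
move=> ab nobd.
pose E := [set v | a <= v <= b /\ forall w, a <= w <= v -> T w <-> T a].
have Ea : E a by split=> [|w aw]; [rewrite lexx|have -> : w = a by apply/le_anti; rewrite andbC].
have ubE : ubound E b by move=> v [/andP[]].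
have supE : has_sup E by split; [exists a|exists b].
have sab : a <= sup E <= b.
  by apply/andP; split; [apply: ub_le_sup => //; exists b|apply: ge_sup => //; exists a].
have [c [d [/andP[cs sd] cst]]] := boundaryPn (nobd _ sab).
have [v Ev cv] : exists2 v, E v & c < v.
  have sc : 0 < sup E - c by rewrite subr_gt0.
  by have [v Ev] := sup_adherent sc supE; rewrite subKr => cv; exists v.
have vs : v <= sup E by apply: ub_le_sup => //; exists b.
have ext w : v <= w < d -> w <= b -> E w.
  move=> /andP[vw wd] wb; case: Ev => /andP[av vb] Ev.
  split=> [|x /andP[ax xw]]; first by rewrite wb (le_trans av).
  have [xv|/ltW vx] := leP x v; first by apply: Ev; rewrite ax.
  rewrite -(Ev v) ?av ?lexx //.
  have [vcd xcd] : c < v < d /\ c < x < d.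
    by rewrite cv (le_lt_trans vw wd) (lt_le_trans cv vx) (le_lt_trans xw wd).
  by rewrite (cst _ vcd) (cst _ xcd).
have [bs|sb] := leP b (sup E).
  have [|_ Eb] := ext b _ (lexx b).
    by rewrite (le_trans vs) //= ?(le_lt_trans bs) //; case/andP: sab.
  by rewrite (Eb b) // ab lexx.
have [w /andP[sw]] : exists w : R, sup E < w < Num.min b d.
  by exists ((sup E + Num.min b d) / 2); rewrite !midf_lt // lt_min sb.
rewrite lt_min => /andP[wb wd].
have /(ub_le_sup (ex_intro _ b ubE)) : E w.
  by apply: ext; rewrite ?(ltW wb) // wd (le_trans vs) // ltW.
by rewrite leNgt sw.
Qed.

End DefinableSubsetsOfTheLine.

(** * Uniform finiteness *)

Section UniformFiniteness.
Context {R : realType} (S : ominStructure R).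
Local Notation env := (env R).
Implicit Types (P : env -> Prop) (T : set R) (l : seq R).

Lemma rat_between (a b : R) : a < b -> exists r : rat, a < ratr r < b.
Proof. by move=> /rat_in_itvoo[r]; rewrite in_itv; exists r. Qed.

(** Separators are rational because [stable_dense] has to index its conditions by a countable
    set. *)
Lemma seq_gap_right l (q : R) : exists r : rat, q < ratr r /\
  forall s, s \in l -> q < s -> ratr r < s.
Proof.
elim: l => [|x l [r [qr rl]]].
  have [|r /andP[qr _]] := @rat_between q (q + 1); first by rewrite ltrDl.
  by exists r.
have [qx|xq] := ltP q x; last first.
  exists r; split=> // s; rewrite in_cons => /predU1P[->|/rl//].
  by rewrite ltNge xq.
have [|r' /andP[qr']] := @rat_between q (Num.min x (ratr r)).
  by rewrite lt_min qx.
rewrite lt_min => /andP[r'x r'r]; exists r'; split=> // s.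
by rewrite in_cons => /predU1P[-> //|/rl sl /sl]; apply: lt_trans.
Qed.

Lemma seq_gap_left l (q : R) : exists r : rat, ratr r < q /\
  forall s, s \in l -> s < q -> s < ratr r.
Proof.
have [r [qr rl]] := seq_gap_right [seq - s | s <- l] (- q).
exists (- r); rewrite rmorphN /= -ltrN2 opprK; split=> // s sl sq.
by rewrite ltrNr; apply: rl; rewrite ?ltrN2 // map_f.
Qed.

Lemma seq_bounds l : exists q q' : rat, forall s, s \in l -> ratr q < s < ratr q'.
Proof.
elim: l => [|x l [a [b ab]]]; first by exists 0, 0.
have [|a' /andP[_]] := @rat_between (Num.min x (ratr a) - 1) (Num.min x (ratr a)).
  by rewrite gtrBl.
have [|b' /andP[+ _]] := @rat_between (Num.max x (ratr b)) (Num.max x (ratr b) + 1).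
  by rewrite ltrDl.
rewrite lt_min gt_max => /andP[xb' bb'] /andP[a'x a'a]; exists a', b' => s.
rewrite in_cons => /predU1P[->|/ab/andP[as_ sb]]; first by rewrite a'x.
by rewrite (lt_trans a'a) ?(lt_trans sb).
Qed.

Lemma seq_max l (p : pred R) : has p l -> exists2 x, x \in l & p x /\
  forall y, y \in l -> p y -> y <= x.
Proof.
elim: l => //= x l IH; have [/IH{IH}[u ul [pu uM]] _|nl] := boolP (has p l).
  have [/andP[px ux]|npx] := boolP (p x && (u <= x)).
    exists x; rewrite ?mem_head //; split=> // y; rewrite in_cons => /predU1P[->//|yl py].
    exact: le_trans (uM _ yl py) ux.
  exists u; rewrite ?in_cons ?ul ?orbT //; split=> // y.
  rewrite in_cons => /predU1P[-> px|]; last exact: uM.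
  by move: npx; rewrite px -ltNge => /ltW.
rewrite orbF => px; exists x; rewrite ?mem_head //; split=> // y.
rewrite in_cons => /predU1P[->//|yl py].
by case/hasP: nl; exists y.
Qed.

Lemma seq_min l (p : pred R) : has p l -> exists2 x, x \in l & p x /\
  forall y, y \in l -> p y -> x <= y.
Proof.
move=> hp; have [|x xl [px xM]] := @seq_max [seq - s | s <- l] (fun x => p (- x)).
  by rewrite has_map; move: hp; apply: sub_has => x /=; rewrite opprK.
move: xl px xM => /mapP[u ul ->]; rewrite opprK => pu uM; exists u => //.
split=> // y yl py; rewrite -lerN2; apply: uM; rewrite ?opprK //.
exact: map_f.
Qed.

Definition near_line (t : R) T := exists a b : R, a < t < b /\ forall u, a < u < b -> T u.

Lemma near_line_and t T T' : near_line t T -> near_line t T' ->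
  near_line t (fun u => T u /\ T' u).
Proof.
move=> [a [b [/andP[at_ tb] Tab]]] [a' [b' [/andP[at' tb'] Tab']]].
exists (Num.max a a'), (Num.min b b'); split; first by rewrite gt_max lt_min at_ at' tb.
move=> u; rewrite gt_max lt_min => /andP[/andP[au au'] /andP[ub ub']].
by split; [apply: Tab; rewrite au|apply: Tab'; rewrite au'].
Qed.

Lemma near_line_sub t T T' : (forall u, T u -> T' u) -> near_line t T -> near_line t T'.
Proof. by move=> TT' [a [b [tab Tab]]]; exists a, b; split=> // u /Tab/TT'. Qed.

Lemma near_line_at t T : near_line t T -> T t.
Proof. by move=> [a [b [tab]]]; apply. Qed.

Lemma near_boundaryPn T t : ~ boundary T t -> T t -> near_line t T.
Proof.
move=> /boundaryPn[a [b [tab Tab]]] Tt; exists a, b; split=> // u uab.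
exact/(Tab _ uab).
Qed.

Lemma near_boundaryPnN T t : ~ boundary T t -> ~ T t -> near_line t (fun u => ~ T u).
Proof.
move=> /boundaryPn[a [b [tab Tab]]] Tt; exists a, b; split=> // u uab.
by rewrite (Tab _ uab).
Qed.

Definition has_card (n : nat) T :=
  exists l, [/\ sorted <%R l, size l = n & forall t, T t <-> t \in l].

Definition card_le (n : nat) T := exists2 l, (size l <= n)%N & forall t, T t -> t \in l.

Lemma finite_has_card T : finite_set T -> exists n, has_card n T.
Proof.
move=> /finite_seqP[l ->]; exists (size (sort <=%R (undup l))), (sort <=%R (undup l)).
split=> // [|t]; first by rewrite sort_lt_sorted undup_uniq.
by rewrite mem_sort mem_undup.
Qed.

Lemma has_card_le n m T : has_card n T -> card_le m T <-> (n <= m)%N.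
Proof.
move=> [l [sl <- Tl]]; split=> [[l' sl' Tl']|lm].
  apply: leq_trans sl'; apply: uniq_leq_size; first exact: lt_sorted_uniq.
  by move=> t; rewrite -Tl => /Tl'.
by exists l => // t; rewrite -Tl.
Qed.

Lemma has_card_inj n m T : has_card n T -> has_card m T -> n = m.
Proof.
move=> Tn Tm; apply/eqP; rewrite eqn_leq.
by apply/andP; split; [apply/(has_card_le _ Tn)/(has_card_le _ Tm)|
  apply/(has_card_le _ Tm)/(has_card_le _ Tn)].
Qed.

Lemma has_card_ext n T T' : (forall t, T t <-> T' t) -> has_card n T -> has_card n T'.
Proof. by move=> TT' [l [? ? Tl]]; exists l; split=> // t; rewrite -TT'. Qed.

Lemma card_le_sub n T T' : (forall t, T t -> T' t) -> card_le n T' -> card_le n T.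
Proof. by move=> TT' [l ? Tl]; exists l => // t /TT'/Tl. Qed.

Lemma card_le_finite n T : card_le n T -> finite_set T.
Proof. by move=> [l _ Tl]; apply: sub_finite_set (finite_seq l). Qed.

(** * One-parameter families of finite subsets of the line *)

Section OneParameterFamily.
Variable A : R -> set R.

(** The interval is closed here and open in [unique_at]: for a finite [A t], the former can be
    enlarged, and the latter shrunk, to rational bounds without losing the condition. *)
Definition empty_at (q q' u : R) := forall s : R, q <= s <= q' -> ~ A u s.

Definition unique_at (q q' u : R) :=
  exists s : R, (q < s < q' /\ A u s) /\ forall s' : R, q < s' < q' -> A u s' -> s' = s.

(* A first-order condition which forces the cardinality of A u to be constant
   for u near t. *)
Definition stable_at (t : R) := [/\
  exists a b : R, near_line t (fun u => forall s : R, A u s -> a < s < b),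
  forall q q' : R, empty_at q q' t -> near_line t (empty_at q q') &
  forall q q' : R, ~ A t q -> ~ A t q' -> unique_at q q' t -> near_line t (unique_at q q')].

(** Points are peeled off from the left. The first point [s1] beyond [q] is isolated by a rational
    [r] in the gap after it; nearby fibres keep one point between [q] and [r] and avoid [r], and the
    induction goes on beyond [r]. The common bounds [a], [b] ensure that no point comes in from
    infinity. *)
Lemma stable_has_card t n : stable_at t -> has_card n (A t) ->
  near_line t (fun u => has_card n (A u)).
Proof.
move=> [[a [b nab]] st0 st1] cn.
have step q k : ~ A t q -> has_card k (fun s => A t s /\ q < s) ->
    near_line t (fun u => has_card k (fun s => A u s /\ q < s)).
  elim: k q => [|k IH] q nAq [l [sl szl Al]].
    have l0 : l = [::] by case: l szl {sl Al}.
    have /st0 st : empty_at q (Num.max q b) t.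
      move=> s /andP[qs _] As; have [qs'|sq] := ltP q s.
        by have /Al := conj As qs'; rewrite l0.
      by apply: nAq; have -> : q = s by apply/le_anti; rewrite qs.
    apply: near_line_sub (near_line_and nab st) => u [uab eu].
    exists [::]; split=> // s; split=> // -[As qs].
    by case: (eu s) => //; rewrite (ltW qs) le_max (ltW (andP (uab _ As)).2) orbT.
  case: l sl szl Al => // s1 l sl [szl] Al.
  have [r [s1r rl]] := seq_gap_right l s1.
  have s1l s : s \in l -> s1 < s.
    by move=> ls; have /allP := order_path_min (@lt_trans _ _) sl; apply.
  have [As1 qs1] : A t s1 /\ q < s1 by apply/Al; rewrite mem_head.
  have Al' s : A t s /\ ratr r < s <-> s \in l.
    split=> [[As rs]|ls].
      have : s \in s1 :: l by apply/Al; split=> //; rewrite (lt_trans qs1) ?(lt_trans s1r).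
      by rewrite in_cons => /predU1P[s1E|//]; move: rs; rewrite s1E ltNge ltW.
    have [|Ats _] := (Al s).2; first by rewrite in_cons ls orbT.
    by split=> //; apply: rl => //; exact: s1l.
  have nAr : ~ A t (ratr r).
    move=> Ar; have : ratr r \in s1 :: l.
      by apply/Al; split=> //; apply: lt_trans s1r.
    rewrite in_cons => /predU1P[rE|/[dup]/s1l s1r' /rl]; first by rewrite rE ltxx in s1r.
    by move=> /(_ s1r'); rewrite ltxx.
  have uq : unique_at q (ratr r) t.
    exists s1; split=> [|s /andP[qs sr] As]; first by rewrite qs1.
    have : s \in s1 :: l by apply/Al.
    by rewrite in_cons => /predU1P[//|/Al'[_]]; rewrite ltNge (ltW sr).
  have /st0 er : empty_at (ratr r) (ratr r) t.
    by move=> s; rewrite -eq_le => /eqP <-.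
  have /IH/(_ _)/wrap[] := nAr; first by exists l; split=> //; exact: path_sorted sl.
  move=> /near_line_and/(_ (near_line_and er (st1 _ _ nAq nAr uq))).
  apply: near_line_sub => u [[l' [sl' szl' Al'']] [eu [s' [[/andP[qs' s'r] As'] us']]]].
  exists (s' :: l'); split; rewrite /= ?szl' //.
    rewrite path_sortedE; last exact: lt_trans.
    rewrite sl' andbT; apply/allP => s /Al''[_]; exact: lt_trans.
  move=> s; rewrite in_cons; split=> [[As qs]|/predU1P[->//|/Al''[As rs]]]; last first.
    by split=> //; rewrite (lt_trans _ rs) // (lt_trans qs').
  have [sr|rs|sr] := ltgtP s (ratr r).
  - by rewrite (us' s) ?eqxx // qs.
  - by apply/orP; right; apply/Al''.
  - by case: (eu s) => //; rewrite sr lexx.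
have tab := near_line_at nab; have nAa : ~ A t a by move=> /tab; rewrite ltxx.
have ext u : (forall s : R, A u s -> a < s < b) -> forall s, A u s /\ a < s <-> A u s.
  by move=> uab s; split=> [[]//|As]; have /andP[] := uab _ As.
have := step a n nAa (has_card_ext (fun s => iff_sym (ext t tab s)) cn).
move=> /(near_line_and nab); apply: near_line_sub => u [/ext uab].
exact: has_card_ext.
Qed.

(** At a boundary point of the locus where the cardinality is [n], nearby fibres would have
    different cardinalities, against [stable_has_card]. *)
Lemma stable_card_const n a b : a <= b -> (forall t, finite_set (A t)) ->
  (forall t, a <= t <= b -> stable_at t) -> has_card n (A a) <-> has_card n (A b).
Proof.
move=> ab fA st; apply: (@boundary_free_const _ (fun t => has_card n (A t))) => // t tab bd.
have [m cm] := finite_has_card (fA t).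
have [c [d [/bd[[u [ucd un]] [v [vcd vn]]] cdm]]] := stable_has_card (st _ tab) cm.
by apply: vn; rewrite (has_card_inj un (cdm _ ucd)); exact: cdm.
Qed.

End OneParameterFamily.

(** The countably many sets [T i] have finite boundaries, which cannot cover an interval. At a point
    outside all of them, each condition of [stable_at] follows from conditions with rational bounds,
    and these persist nearby. *)
Lemma stable_dense P x a b : defpred S P ->
  (forall t, finite_set (fun s => P (scons s (scons t x)))) -> a < b ->
  exists2 t, a < t < b & stable_at (fun u s => P (scons s (scons u x))) t.
Proof.
move=> dP fin ab; set A := fun u s => P (scons s (scons u x)).
pose T (i : rat * rat * (bool * bool)) : set R :=
  let: (q, q', k) := i in match k with
  | (true, true) => fun t => exists s : R, ratr q <= s <= ratr q' /\ A t s
  | (true, false) => unique_at A (ratr q) (ratr q')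
  | (false, true) => fun t => exists s : R, A t s /\ ratr q <= s
  | (false, false) => fun t => exists s : R, A t s /\ s <= ratr q
  end.
have dT i : defline S (T i).
  (* The formulas below read the environment as [t], [q], [q'] followed by [x], whence [sdrop 3]. *)
  have fx (Q : env -> Prop) (q q' : R) : defpred S Q ->
    defline S (fun t => Q (scons t (scons q (scons q' x)))) by exact: defpred_line.
  have dQ0 : defpred S (fun e => exists s : R, e 1%N <= s <= e 2%N /\
      P (scons s (scons (e 0%N) (sdrop 3 e)))) by solve_defpred.
  have dQ1 : defpred S (fun e => exists s : R, (e 1%N < s < e 2%N /\
      P (scons s (scons (e 0%N) (sdrop 3 e)))) /\ forall s' : R, e 1%N < s' < e 2%N ->
      P (scons s' (scons (e 0%N) (sdrop 3 e))) -> s' = s) by solve_defpred.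
  have dQ2 : defpred S (fun e => exists s : R, P (scons s (scons (e 0%N) (sdrop 3 e))) /\
     e 1%N <= s) by solve_defpred.
  have dQ3 : defpred S (fun e => exists s : R, P (scons s (scons (e 0%N) (sdrop 3 e))) /\
     s <= e 1%N) by solve_defpred.
  case: i => [[q q'] [[] []]].
  - exact: (fx _ (ratr q) (ratr q') dQ0).
  - exact: (fx _ (ratr q) (ratr q') dQ1).
  - exact: (fx _ (ratr q) (ratr q') dQ2).
  - exact: (fx _ (ratr q) (ratr q') dQ3).
have [t tab nbd] : exists2 t, a < t < b & forall i, ~ boundary (T i) t.
  apply: contrapT => nt.
  have [|i] := @uncountable_itv _ _ (fun i => boundary (T i)) _ _ ab.
    move=> t tab; apply: contrapT => /forallNP nbd; apply: nt; exists t => //.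
  by apply; apply: boundary_finite.
have /finite_seqP[l lE] : finite_set (A t) by exact: fin.
have Al s : A t s <-> s \in l by rewrite lE.
have st1 (q q' : R) : empty_at A q q' t -> near_line t (empty_at A q q').
  move=> eqq.
  have [r [rq rl]] := seq_gap_left l q; have [r' [qr' r'l]] := seq_gap_right l q'.
  have n1 : ~ T (r, r', (true, true)) t.
    move=> [s [/andP[rs sr'] /[dup] As /Al sl]].
    have [sq|qs] := ltP s q; first by have := rl _ sl sq; rewrite ltNge rs.
    have [qs'|sq'] := ltP q' s; first by have := r'l _ sl qs'; rewrite ltNge sr'.
    by case: (eqq s); rewrite ?qs.
  apply: near_line_sub (near_boundaryPnN (nbd _) n1) => u m1 s /andP[qs sq'] As.
  apply: m1; exists s; split=> //.
  by rewrite (le_trans (ltW rq)) //= (le_trans sq') // ltW.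
exists t => //; split=> //.
- have [q [q' ql]] := seq_bounds l; exists (ratr q), (ratr q').
  have n1 : ~ T (q', q', (false, true)) t.
    by move=> [s [/Al/ql/andP[_ sq']]]; rewrite leNgt sq'.
  have n2 : ~ T (q, q', (false, false)) t.
    by move=> [s [/Al/ql/andP[qs _]]]; rewrite leNgt qs.
  apply: near_line_sub (near_line_and (near_boundaryPnN (nbd _) n1)
    (near_boundaryPnN (nbd _) n2)) => u [m1 m2] s As.
  by rewrite !ltNge; apply/andP; split; apply/negP => ?; [apply: m2|apply: m1]; exists s.

- move=> q q' nAq nAq' [s0 [[/andP[qs0 s0q'] As0] us0]].
  (* Passing to rational bounds leaves the strips from [q] to [r] and from [r'] to [q']; they miss
     [A t], and [st1] keeps them empty nearby. *)
  have [r [qr rl]] := seq_gap_right l q; have [r' [r'q' r'l]] := seq_gap_left l q'.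
  have e1 : empty_at A q (ratr r) t.
    move=> s; rewrite le_eqVlt => /andP[/predU1P[<-//|qs] sr] /Al sl.
    by have := rl _ sl qs; rewrite ltNge sr.
  have e2 : empty_at A (ratr r') q' t.
    move=> s; rewrite [X in _ && X]le_eqVlt => /andP[rs /predU1P[->//|sq']] /Al sl.
    by have := r'l _ sl sq'; rewrite ltNge rs.
  have uq : T (r, r', (true, false)) t.
    exists s0; split=> [|s /andP[rs sr']].
      by split=> //; rewrite rl ?r'l //; exact/Al.
    by apply: us0; rewrite (lt_trans qr) ?(lt_trans sr').
  have := near_line_and (near_boundaryPn (nbd _) uq) (near_line_and (st1 _ _ e1) (st1 _ _ e2)).
  apply: near_line_sub => u [[s [/= [/andP[rs sr'] As] us]] [m1 m2]].
  exists s; split=> [|v /andP[qv vq'] Av].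
    by split=> //; rewrite (lt_trans qr) ?(lt_trans sr').
  apply: us => //; rewrite !ltNge; apply/andP; split; apply/negP => ?.
    by apply: (m1 v) => //; apply/andP; split; rewrite // ltW.
  by apply: (m2 v) => //; apply/andP; split; rewrite // ltW.
Qed.

(* Every component of the complement of [B] contains a midpoint of two elements
   of [pad B]. *)
Definition pad (B : set R) : set R := fun t =>
  t = 0 \/ B t \/ exists u o : R, B u /\ o = 1 /\ (u + o = t \/ t + o = u).

(** The sum is named [w], as the constant 1 is named [o] in [pad], to stay within formulas that
    [solve_defpred] accepts. *)
Definition midpoints (B : set R) : set R := fun t =>
  exists u v w : R, pad B u /\ pad B v /\ t + t = w /\ u + v = w.

Lemma midpoints_finite B : finite_set B -> finite_set (midpoints B).
Proof.
move=> fB; have fP : finite_set (pad B).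
  apply: (@sub_finite_set _ _ (([set 0] `|` B) `|` ([set x + 1 | x in B] `|` [set x - 1 | x in B]))).
    move=> t [->|[Bt|[u [o [Bu [-> [<-|tu]]]]]]]; [left; left|left; right|right; left|right; right] => //.
      by exists u.
    by exists u; rewrite // -tu addrK.
  by rewrite !finite_setU; do !split=> //; apply: finite_image.
apply: sub_finite_set (finite_image2 (fun u v => (u + v) / 2) fP fP) => t.
move=> [u [v [w [Pu [Pv [tw uv]]]]]]; exists u => //; exists v => //.
by rewrite uv -tw mulrDl -splitr.
Qed.

Lemma midpoints_pad B u v : pad B u -> pad B v -> midpoints B ((u + v) / 2).
Proof.
by move=> Pu Pv; exists u, v, (u + v); do !split=> //; rewrite -splitr.
Qed.

(** The nearest points of [B] on the two sides of [t] decide: their midpoint if both exist, a shift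
    by 1 of the only one, and 0 if there is none. *)
Lemma midpoints_reach B t : finite_set B -> exists2 t', midpoints B t' &
  t' = t \/ forall v, Num.min t t' <= v <= Num.max t t' -> ~ B v.
Proof.
move=> /finite_seqP[l ->]; set B' := [set` l].
have mid1 u : pad B' u -> midpoints B' u.
  by move=> Pu; have := midpoints_pad Pu Pu; rewrite mulrDl -splitr.
have [tl|tl] := boolP (t \in l).
  by exists t; [apply: mid1; right; left|left].
have nbt s : s \in l -> s < t \/ t < s.
  by move=> sl; apply/orP; rewrite -neq_lt; apply: contraNneq tl => <-.
have [/seq_max[u ul [/= ut uM]]|nlt] := boolP (has (< t) l);
  have [/seq_min[v vl [/= tv vm]]|ngt] := boolP (has (> t) l).
- exists ((u + v) / 2); first by apply: midpoints_pad; right; left.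
  right=> w; rewrite ge_min le_max => /andP[wl wr] /= wB.
  have [uv vv] : u < (u + v) / 2 /\ (u + v) / 2 < v by rewrite !midf_lt // (lt_trans ut).
  case: (nbt _ wB) => [wt|tw].
    by have := uM _ wB wt; lra.
  by have := vm _ wB tw; lra.
- exists (u + 1).
    by apply: mid1; right; right; exists u, 1; do !split=> //; left.
  right=> w; rewrite ge_min le_max => /andP[wl wr] /= wB.
  case: (nbt _ wB) => [wt|tw]; first by have := uM _ wB wt; lra.
  by case/hasP: ngt; exists w.
- exists (v - 1).
    by apply: mid1; right; right; exists v, 1; do !split=> //; right; rewrite subrK.
  right=> w; rewrite ge_min le_max => /andP[wl wr] /= wB.
  case: (nbt _ wB) => [wt|tw]; last by have := vm _ wB tw; lra.
  by case/hasP: nlt; exists w.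
- exists 0; first by apply: mid1; left.
  right=> w _ wB; case: (nbt _ wB) => [wt|tw].
    by case/hasP: nlt; exists w.
  by case/hasP: ngt; exists w.
Qed.

Lemma defpred_unstable P : defpred S P ->
  defpred S (fun e => ~ stable_at (fun u s => P (scons s (scons u (stail e)))) (e 0%N)).
Proof.
move=> dP; apply: defpred_not; apply: (@defpred_ext _ _ (fun e =>
   (exists a b c d : R, c < e 0%N < d /\ forall u : R, c < u < d ->
     forall s : R, P (scons s (scons u (stail e))) -> a < s < b) /\
   (forall q q' : R, (forall s : R, q <= s <= q' -> ~ P (scons s e)) ->
     exists c d : R, c < e 0%N < d /\ forall u : R, c < u < d ->
     forall s : R, q <= s <= q' -> ~ P (scons s (scons u (stail e)))) /\
   (forall q q' : R, ~ P (scons q e) -> ~ P (scons q' e) ->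
     (exists s : R, (q < s < q' /\ P (scons s e)) /\
       forall s' : R, q < s' < q' -> P (scons s' e) -> s' = s) ->
     exists c d : R, c < e 0%N < d /\ forall u : R, c < u < d ->
     (exists s : R, (q < s < q' /\ P (scons s (scons u (stail e)))) /\
       forall s' : R, q < s' < q' -> P (scons s' (scons u (stail e))) -> s' = s)))).
  by move=> e; rewrite /stable_at /empty_at /unique_at scons_stail; split=> [[? []]|[]].
solve_defpred.
Qed.

(** Induction on the number of parameters. The cardinality is constant on each component of the
    stable values of the first parameter, and finitely many midpoints represent all components and
    the unstable values. The union [Q] of the fibres over them is finite and has one parameter less;
    a bound for [Q] bounds every fibre. *)
Theorem uniform_finiteness k P : defpred S P -> supported k.+1 P ->
  (forall e, finite_set (fun s => P (scons s e))) ->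
  exists N, forall e, card_le N (fun s => P (scons s e)).
Proof.
elim: k P => [|k IH] P dP sP fin.
  have [N cN] := finite_has_card (fin (fun=> 0)); exists N => e.
  apply: (@card_le_sub _ _ (fun s => P (scons s (fun=> 0)))); last exact/(has_card_le _ cN).
  by move=> s; apply: sP; case.
pose A (x : env) (t s : R) := P (scons s (scons t x)).
have Aext x y t : (forall i, (i < k)%N -> x i = y i) -> A x t = A y t.
  by move=> xy; apply/funext => s; apply: (supported_eq sP); do 2?case=> //.
pose B x : set R := fun t => ~ stable_at (A x) t.
have finB x : finite_set (B x).
  have dB := @defpred_line _ S _ x (defpred_unstable dP).
  apply: (defline_finite dB) => a b ab.
  have [t tab st] := stable_dense dP (fun t => fin (scons t x)) ab.
  by exists t => //; apply.
pose Q (e : env) := exists t : R, midpoints (B (stail e)) t /\ A (stail e) t (e 0%N).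
have dQ : defpred S Q.
  rewrite /Q /midpoints /pad.
  have dB := defpred_unstable dP.
  have dB' (v : env -> R) F : coordinate v -> reindexing F -> defpred S (fun e => B (F e) (v e)).
    move=> cv rF; apply: (@defpred_reindex _ _ _ (fun e => scons (v e) (F e)) dB).
    exact: reindexing_scons.
  rewrite /A; solve_defpred; apply: dB'; solve_reindexing.
have sQ : supported k.+1 Q.
  move=> e e' ee' [t [Mt At]]; exists t.
  have BE : A (stail e) = A (stail e').
    by apply/funext => u; apply: Aext => i ik; apply: ee'.
  by move: Mt At; rewrite /B BE ee'.
have [e|N QN] := IH Q dQ sQ.
  apply: (@sub_finite_set _ _ (\bigcup_(t in midpoints (B e)) A e t)).
    by move=> s [t [Mt At]]; exists t.
  by apply: bigcup_finite => [|t _]; [exact/midpoints_finite/finB|exact: fin].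
exists N => e; have [t' Mt' tt'] := midpoints_reach (e 0%N) (finB (stail e)).
have {}QN : card_le N (A (stail e) t').
  by apply: card_le_sub (QN (stail e)) => s As; exists t'.
have -> : (fun s => P (scons s e)) = A (stail e) (e 0%N) by rewrite /A scons_stail.
move: (e 0%N) (stail e) QN Mt' tt' => t x QN _ [<- //|tt'].
have [n cn] := finite_has_card (fin (scons t x)).
have st v : Num.min t t' <= v <= Num.max t t' -> stable_at (A x) v.
  by move=> /tt' nB; apply: contrapT.
have cn' : has_card n (A x t').
  have fA u : finite_set (A x u) by exact: fin.
  have [le|/ltW le] := leP t t'.
    by rewrite min_l // max_r // in st; apply/(stable_card_const n le fA st).
  by rewrite min_r // max_l // in st; apply/(stable_card_const n le fA st).
by apply/(has_card_le _ cn)/(has_card_le _ cn').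
Qed.

End UniformFiniteness.

(** * Counting types over finitely many parameters *)

Section CountingTypes.
Context {R : realType} (S : ominStructure R).
Local Notation env := (env R).
Implicit Types (P X A : env -> Prop) (D : set R).

(** Elements are counted from the left starting at 0; for each fixed [j] the recursion unfolds to a
    first-order formula. *)
Fixpoint nth_point D (j : nat) (u : R) : Prop :=
  if j is j'.+1 then
    D u /\ exists w : R, nth_point D j' w /\ w < u /\ forall v : R, D v -> v <= w \/ u <= v
  else D u /\ forall v : R, D v -> u <= v.

Lemma nth_point_inj D j u v : nth_point D j u -> nth_point D j v -> u = v.
Proof.
elim: j u v => [|j IH] u v /=.
  by move=> [Du uD] [Dv vD]; apply/le_anti; rewrite uD ?vD.
move=> [Du [w [wj [wu uD]]]] [Dv [w' [/(IH _ _ wj) <- [wv vD]]]].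
apply/le_anti/andP; split.
  by case: (uD _ Dv) => //; rewrite leNgt wv.
by case: (vD _ Du) => //; rewrite leNgt wu.
Qed.

Lemma nth_point_exists D N u : card_le N D -> D u -> exists2 j, (j < N)%N & nth_point D j u.
Proof.
move=> DN; have [n cn] := finite_has_card (card_le_finite DN).
have nN : (n <= N)%N by apply/(has_card_le _ cn).
case: cn => l [sl szl Dl] /Dl ul.
exists (index u l); first by rewrite (leq_trans _ nN) // -szl index_mem.
suff nthl j : (j < size l)%N -> nth_point D j (nth 0 l j).
  by have := nthl (index u l); rewrite index_mem nth_index //; apply.
elim: j => [|j IH] jl /=.
  split; first exact/Dl/mem_nth.
  by move=> v /Dl /(nthP 0)[i il <-]; rewrite (lt_sorted_leq_nth 0 sl) // inE.
split; first exact/Dl/mem_nth.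
exists (nth 0 l j); split; first exact/IH/ltnW.
split; first by rewrite (lt_sorted_ltn_nth 0 sl) ?inE // ltnW.
move=> v /Dl /(nthP 0)[i il <-]; rewrite !(lt_sorted_leq_nth 0 sl) ?inE ?(ltnW jl) //.
by have [ij|ji] := leqP i j; [left|right].
Qed.

Lemma defpred_nth_point P j : defpred S P ->
  defpred S (fun e => nth_point (fun u => P (scons u (stail e))) j (e 0%N)).
Proof.
move=> dP; elim: j => [|j IH] /=; first by solve_defpred.
have IH' v F : coordinate v -> reindexing F ->
    defpred S (fun e => nth_point (fun u => P (scons u (F e))) j (v e)).
  move=> cv rF; apply: (@defpred_reindex _ _ _ (fun e => scons (v e) (F e)) IH).
  exact: reindexing_scons.
solve_defpred; apply: IH'; solve_reindexing.
Qed.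

Definition fiber_boundary P (e : env) : set R := boundary (fun t => P (scons t e)).

Lemma defpred_boundary P : defpred S P ->
  defpred S (fun e => fiber_boundary P (stail e) (e 0%N)).
Proof. by move=> dP; rewrite /fiber_boundary /boundary; solve_defpred. Qed.

Lemma fiber_boundary_supp k P e e' : supported k.+1 P ->
  (forall i, (i < k)%N -> e i = e' i) -> fiber_boundary P e = fiber_boundary P e'.
Proof.
move=> sP ee'; rewrite /fiber_boundary; congr boundary; apply/funext => t.
by apply: (supported_eq sP); case.
Qed.

Lemma defpred_boundary_point P j v F : defpred S P -> coordinate v -> reindexing F ->
  defpred S (fun e => nth_point (fiber_boundary P (F e)) j (v e)).
Proof.
move=> dP cv rF; have dj := defpred_nth_point j (defpred_boundary dP).
apply: (@defpred_reindex _ _ _ (fun e => scons (v e) (F e)) dj).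
exact: reindexing_scons.
Qed.

Lemma fiber_boundary_card P : defpred S P ->
  exists N, forall e, card_le N (fiber_boundary P e).
Proof.
move=> dP; have [k sPk _] := dP; have sP : supported k.+1 P by exact: supported_leq sPk.
apply: (@uniform_finiteness _ S k _ (defpred_boundary dP)).
  move=> e e' ee'; rewrite (@fiber_boundary_supp k P (stail e) (stail e')) ?ee' //.
  by move=> i ik; apply: ee'.
by move=> e; exact: boundary_finite (defpred_line e dP).
Qed.

Definition type_of P m (B : seq env) (x : env) : seq bool :=
  [seq `[< P (scat m x b) >] | b <- B].

(** [P] is quantified here because the induction on [m] passes to auxiliary formulas. The constant
    may depend on [P] but not on [B]; nonemptiness of [B] lets the exponent be raised, as in
    [types_le_leq]. *)
Definition types_le d m X := forall P, defpred S P -> exists C : nat,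
  forall B : seq env, (0 < size B)%N ->
  exists2 L : seq (seq bool), (size L <= C * size B ^ d)%N &
    forall x, X x -> type_of P m B x \in L.

Lemma types_le_leq d d' m X : (d <= d')%N -> types_le d m X -> types_le d' m X.
Proof.
move=> dd' tX P /tX[C PC]; exists C => B B0; have [L sL XL] := PC B B0; exists L => //.
by apply: leq_trans sL _; rewrite leq_mul2l leq_pexp2l ?orbT.
Qed.

Lemma types_leU d m X X' : types_le d m X -> types_le d m X' ->
  types_le d m (fun e => X e \/ X' e).
Proof.
move=> tX tX' P dP; have [C PC] := tX P dP; have [C' PC'] := tX' P dP.
exists (C + C')%N => B B0; have [L sL XL] := PC B B0; have [L' sL' XL'] := PC' B B0.
exists (L ++ L'); first by rewrite size_cat mulnDl leq_add.
by move=> x [/XL|/XL'] xL; rewrite mem_cat xL ?orbT.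
Qed.

Lemma types_le0 X : types_le 0 0 X.
Proof.
move=> P _; exists 1%N => B _; exists [:: type_of P 0 B (fun=> 0)] => //.
move=> x _; rewrite inE; apply/eqP/eq_map => b.
by rewrite !scat0.
Qed.

(** The last coordinate is determined by the others through [F], so it can be quantified away: the
    type for [P] is the type of the projected point for one auxiliary formula. *)
Lemma types_le_graph d m A X F : types_le d m A -> defpred S F -> supported m.+1 F ->
  (forall e, X e -> A (stail e) /\ F e) ->
  (forall t e, F e -> F (scons t (stail e)) -> t = e 0%N) ->
  types_le d m.+1 X.
Proof.
move=> tA dF sF XF Finj P dP.
have [|C PC] := tA (fun e => exists t : R, F (scons t e) /\ P (scons t e)).
  by solve_defpred.
exists C => B /PC[L sL XL]; exists L => // x /[dup] Xx /XF[/XL + Fx].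
rewrite (_ : type_of _ m B _ = type_of P m.+1 B x) //; apply: eq_map => b.
have FE t : F (scons t (scat m (stail x) b)) = F (scons t (stail x)).
  by apply: (supported_eq sF); case=> //= i im; rewrite scat_lt.
rewrite scatS; apply: asbool_equiv_eq; split=> [[t []]|Px]; last first.
  by exists (x 0%N); rewrite FE scons_stail.
by rewrite FE => /(Finj _ _ Fx) ->.
Qed.

Lemma size_flatten_le (T : eqType) (T' : Type) (F : T -> seq T') (s : seq T) K :
  (forall a, a \in s -> (size (F a) <= K)%N) ->
  (size (flatten [seq F a | a <- s]) <= size s * K)%N.
Proof.
elim: s => //= a s IH FK; rewrite size_cat mulSn leq_add ?FK ?mem_head //.
by apply: IH => b bs; apply: FK; rewrite in_cons bs orbT.
Qed.

(** A parameter in [types_le] is a single environment; interleaving packs two into one, for formulas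
    that compare the fibres over two parameters. *)
Definition interleave (b b' : env) : env :=
  fun i => if odd i then b' i./2 else b i./2.

Definition even_part m i := if (i < m)%N then i else (m + (i - m).*2)%N.
Definition odd_part m i := if (i < m)%N then i else (m + (i - m).*2.+1)%N.

Lemma even_part_scat m x b b' :
  ssel (even_part m) (scat m x (interleave b b')) = scat m x b.
Proof.
apply/funext => i; rewrite /ssel /even_part /scat.
have [im|mi] := ltnP i m; first by rewrite im.
by rewrite ltnNge leq_addr /= addKn /interleave odd_double doubleK.
Qed.

Lemma odd_part_scat m x b b' :
  ssel (odd_part m) (scat m x (interleave b b')) = scat m x b'.
Proof.
apply/funext => i; rewrite /ssel /odd_part /scat.
have [im|mi] := ltnP i m; first by rewrite im.
by rewrite ltnNge leq_addr /= addKn /interleave /= odd_double uphalf_double.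
Qed.

(* The type of [t] over the fibres of [P] is that of the largest boundary point
   below [t], of its right germ, or of the germ at -oo. This boundary point is
   determined by one parameter [b] and an index [j < N], where [N] is uniform;
   hence only one factor [size B] is lost. *)
Lemma types_le_band d m A X : types_le d m A -> (forall e, X e -> A (stail e)) ->
  types_le d.+1 m.+1 X.
Proof.
move=> tA XA P dP; have [N PN] := fiber_boundary_card dP.
pose ev := ssel (R := R) (even_part m); pose od := ssel (R := R) (odd_part m).
have rev_ F : reindexing F -> reindexing (fun e => ev (F e)) by exact: reindexing_sel.
have rod F : reindexing F -> reindexing (fun e => od (F e)) by exact: reindexing_sel.
pose type_at B x u := [seq `[< P (scons u (scat m x b)) >] | b <- B].
pose germ_at B x u := [seq
  `[< exists v : R, u < v /\ forall t : R, u < t < v -> P (scons t (scat m x b)) >] | b <- B].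
have [j|C1 PC1] := @choice nat nat (fun j C => forall B : seq env, (0 < size B)%N ->
   forall b, exists2 L : seq (seq bool), (size L <= C * size B ^ d)%N &
     forall x, A x -> forall u, nth_point (fiber_boundary P (scat m x b)) j u ->
     type_at B x u \in L /\
     germ_at B x u \in L).
  have dj : defpred S (fun e => nth_point (fiber_boundary P (od (stail e))) j (e 0%N)).
    apply: defpred_boundary_point => //; first by solve_reindexing.
    by apply: rod; solve_reindexing.
  have dP1 : defpred S (fun e => P (scons (e 0%N) (ev (stail e)))).
    apply: (defpred_reindex dP); apply: reindexing_scons; first by solve_reindexing.
    by apply: rev_; solve_reindexing.
  have dP2 : defpred S (fun e => P (scons (e 0%N) (ev (stail (stail (stail e)))))).
    apply: (defpred_reindex dP); apply: reindexing_scons; first by solve_reindexing.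
    by apply: rev_; solve_reindexing.
  (* The odd part carries the fixed parameter, of whose fibre [u] is a boundary point; the even part
     is the parameter at which [P] is tested. As [u] is unique, the two formulas express the type at
     [u] and its right germ. *)
  pose Pa e := exists u : R, nth_point (fiber_boundary P (od e)) j u /\ P (scons u (ev e)).
  pose Pb e := exists u : R, nth_point (fiber_boundary P (od e)) j u /\
      exists v : R, u < v /\ forall t : R, u < t < v -> P (scons t (ev e)).
  have [|Ca PCa] := tA Pa; first by rewrite /Pa; solve_defpred.
  have [|Cb PCb] := tA Pb; first by rewrite /Pb; solve_defpred.
  exists (Ca + Cb)%N => B B0 b.
  have B0' : (0 < size [seq interleave b' b | b' <- B])%N by rewrite size_map.
  have [La sLa XLa] := PCa _ B0'; have [Lb sLb XLb] := PCb _ B0'.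
  exists (La ++ Lb); rewrite size_map in sLa sLb; first by rewrite size_cat mulnDl leq_add.
  move=> x Ax u uj; split; rewrite mem_cat; apply/orP; [left|right].
    rewrite (_ : type_at B x u = type_of Pa m [seq interleave b' b | b' <- B] x) ?XLa //.
    rewrite /type_of -map_comp; apply: eq_map => b' /=.
    rewrite /Pa /ev /od even_part_scat odd_part_scat; apply: asbool_equiv_eq.
    by split=> [Pu|[u' [/(nth_point_inj uj) <-]]] //; exists u.
  rewrite (_ : germ_at B x u = type_of Pb m [seq interleave b' b | b' <- B] x) ?XLb //.
  rewrite /type_of -map_comp; apply: eq_map => b' /=.
  rewrite /Pb /ev /od even_part_scat odd_part_scat; apply: asbool_equiv_eq.
  by split=> [Pu|[u' [/(nth_point_inj uj) <-]]] //; exists u.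
(* Germs at -oo, for the points with no boundary point below them. *)
have [|C2 PC2] := tA (fun e => exists v : R, forall t : R, t < v -> P (scons t e)).
  by solve_defpred.
pose Cm := (\max_(j < N) C1 j)%N.
exists (C2 + N * Cm)%N => B B0.
have [L2 sL2 XL2] := PC2 B B0.
have [[j b]|L1 L1P] := @choice (nat * env) (seq (seq bool)) (fun jb L =>
    (size L <= C1 jb.1 * size B ^ d)%N /\
     forall x, A x -> forall u, nth_point (fiber_boundary P (scat m x jb.2)) jb.1 u ->
     type_at B x u \in L /\
     germ_at B x u \in L).
  by have [L sL XL] := PC1 j B B0 b; exists L.
exists (L2 ++ flatten [seq flatten [seq L1 (j, b) | j <- iota 0 N] | b <- B]).
  rewrite size_cat mulnDl leq_add //.
    by apply: leq_trans sL2 _; rewrite expnS leq_mul2l leq_pmull ?orbT.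
  apply: (@leq_trans (size B * (N * (Cm * size B ^ d)))%N); last first.
    by rewrite expnS mulnCA -!mulnA (mulnCA (size B)).
  apply: size_flatten_le => b bB; rewrite -[X in (X * _)%N](size_iota 0).
  apply: size_flatten_le => j; rewrite mem_iota add0n => /andP[_ jN].
  apply: leq_trans (L1P (j, b)).1 _; rewrite leq_mul2r.
  by rewrite (leq_bigmax (Ordinal jN)) orbT.
move=> x Xx; have Ax := XA _ Xx; set t := x 0%N; set y := stail x in Ax.
(* All boundary points of all fibres over [y] in one finite list; along a segment that avoids [l] no
   truth value changes. *)
have [l lP] : exists l : seq R, forall u,
    u \in l <-> exists2 b, b \in B & fiber_boundary P (scat m y b) u.
  have /finite_seqP[l lE] : finite_set (\bigcup_(b in [set` B]) fiber_boundary P (scat m y b)).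
    apply: bigcup_finite; first exact: finite_seq.
    by move=> b _; apply: card_le_finite (PN _).
  by exists l => u; have <- : (\bigcup_(b in [set` B]) fiber_boundary P (scat m y b)) u = (u \in l)
    by rewrite lE.
have const b u : b \in B -> u <= t -> (forall v, u <= v <= t -> v \notin l) ->
  P (scons u (scat m y b)) <-> P (scons t (scat m y b)).
  move=> bB ut nol.
  apply: (@boundary_free_const _ (fun v => P (scons v (scat m y b)))) => // v vut bd.
  by have /negP := nol _ vut; apply; apply/lP; exists b.
have typeE : type_of P m.+1 B x = type_at B y t.
  by apply: eq_map => b; rewrite scatS.
rewrite mem_cat typeE; have [/seq_max[u ul [/= ut uM]]|nl] := boolP (has (<= t) l); last first.
  apply/orP; left; rewrite (_ : type_at B y t = type_of (fun e =>
    exists v : R, forall t : R, t < v -> P (scons t e)) m B y) ?XL2 //.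
  have nol v : v <= t -> v \notin l.
    by move=> vt; apply: contra nl => vl; apply/hasP; exists v.
  apply/eq_in_map => b bB; apply: asbool_equiv_eq; split=> [Pt|[v Pv]].
    exists t => u ut; apply/(const _ u bB (ltW ut)) => // v /andP[_ vt]; exact: nol.
  (* A point strictly below both [t] and [v], where the germ at -oo and the value at [t] can be
     compared. *)
  pose u := Num.min t v - 1; have [ut uv] : u < t /\ u < v.
    by apply/andP; rewrite -lt_min gtrBl.
  by apply/(const _ u bB (ltW ut)); [move=> w /andP[_ wt]; exact: nol|exact: Pv].
apply/orP; right; have /lP[b bB] := ul => /(nth_point_exists (PN _))[j jN uj].
apply/flattenP; exists (flatten [seq L1 (j, b) | j <- iota 0 N]); first by apply/mapP; exists b.
apply/flattenP; exists (L1 (j, b)).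
  by apply/mapP; exists j; rewrite // mem_iota add0n.
have [_ /(_ y Ax u uj) /= [in1 in2]] := L1P (j, b).
move: ut; rewrite le_eqVlt => /predU1P[<- //|ut].
rewrite (_ : type_at B y t = germ_at B y u) //.
have nol v : u < v -> v <= t -> v \notin l.
  by move=> uv vt; apply/negP => vl; have := uM _ vl vt; rewrite leNgt uv.
apply/eq_in_map => b' bB'; apply: asbool_equiv_eq; split=> [Pt|[v [uv Pv]]].
  exists t; split=> // v /andP[uv vt].
  apply/(const _ v bB' (ltW vt)) => // w /andP[vw wt].
  by apply: nol; rewrite // (lt_le_trans uv).
have [w /andP[uw]] : exists w : R, u < w < Num.min t v.
  by exists ((u + Num.min t v) / 2); rewrite !midf_lt // lt_min ut.
rewrite lt_min => /andP[wt wv].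
apply/(const _ w bB' (ltW wt)); last by apply: Pv; rewrite uw.
by move=> z /andP[wz zt]; apply: nol; rewrite // (lt_le_trans uw).
Qed.

End CountingTypes.

(** * Cells with constant bounds, countable covers and continuity *)

Section BoxCells.
Context {R : realType} (S : ominStructure R).
Local Notation env := (env R).
Implicit Types (P X A C : env -> Prop) (f : env -> R).

Definition box m (l u e : env) := forall i, (i < m)%N -> l i < e i < u i.

Lemma boxS m l u e : box m.+1 l u e <->
  l 0%N < e 0%N < u 0%N /\ box m (stail l) (stail u) (stail e).
Proof.
split=> [b|[b0 b] [|i] //]; first by split=> [|i im]; exact: b.
by rewrite ltnS => /b.
Qed.

Lemma boxI m l u l' u' e : box m l u e -> box m l' u' e ->
  exists l'' u'', box m l'' u'' e /\ forall y, box m l'' u'' y -> box m l u y /\ box m l' u' y.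
Proof.
move=> b b'; exists (fun i => Num.max (l i) (l' i)), (fun i => Num.min (u i) (u' i)).
split=> [i im|y by_].
  by rewrite gt_max lt_min; have /andP[-> ->] := b i im; have /andP[-> ->] := b' i im.
by split=> i /by_; rewrite gt_max lt_min => /andP[/andP[ly ly'] /andP[yu yu']]; rewrite ?ly ?ly'.
Qed.

Definition near_in m C P (e : env) :=
  exists l u : env, box m l u e /\ forall y, C y -> box m l u y -> P y.

Definition continuous_in m C f := forall e, C e -> forall a b : R, a < f e < b ->
  near_in m C (fun y => a < f y < b) e.

Definition open_in m C C' := forall e, C' e -> near_in m C C' e.

Definition local_fun m f := forall e e', (forall i, (i < m)%N -> e i = e' i) -> f e = f e'.

Definition graph_env A f : env -> Prop := fun e => A (stail e) /\ e 0%N = f (stail e).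

(** Cells whose bands have constant bounds. They are easy to shrink, and through [box_cell_cell]
    they give the lower bounds on [odim]. *)
Inductive box_cell : nat -> nat -> (env -> Prop) -> Prop :=
| box_cell_pt : box_cell 0 0 (fun=> True)
| box_cell_graph m d A f : box_cell m d A -> local_fun m f ->
    defpred S (graph_env A f) -> continuous_in m A f -> box_cell m.+1 d (graph_env A f)
| box_cell_band m d A (a b : R) : box_cell m d A -> a < b ->
    box_cell m.+1 d.+1 (fun e => A (stail e) /\ a < e 0%N < b).

Lemma box_cell_supported m d C : box_cell m d C -> supported m C.
Proof.
elim=> {m d C} [|m d A f _ sA lf _ _|m d A a b _ sA _] e e' ee' //.
  move=> [Ae ef]; split; first by apply: sA Ae => i im; apply: ee'.
  by rewrite -ee' // ef; apply: lf => i im; apply: ee'.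
move=> [Ae eab]; split; first by apply: sA Ae => i im; apply: ee'.
by rewrite -ee'.
Qed.

Lemma box_cell_defpred m d C : box_cell m d C -> defpred S C.
Proof.
elim=> {m d C} [|m d A f _ _ _ dG _|m d A a b _ dA _] //; first exact: defpred_true.
apply: (@defpred_ext _ _ (fun e => exists x y : R, x = a /\ y = b /\ A (stail e) /\ x < e 0%N < y)).
  by move=> e; split=> [[x [y [-> [->]]]]|]; last by exists a, b.
solve_defpred.
Qed.

Lemma box_cell_nonempty m d C : box_cell m d C -> exists e, C e.
Proof.
elim=> {m d C} [|m d A f _ [e Ae] _ _ _|m d A a b _ [e Ae] ab]; first by exists (fun=> 0).
  by exists (scons (f e) e).
by exists (scons ((a + b) / 2) e); split; rewrite //= !midf_lt.
Qed.

Lemma defpred_cst (p : Prop) : defpred S (fun=> p).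
Proof.
have [hp|np] := pselect p; first by apply: defpred_ext (defpred_true S).
by apply: defpred_ext (defpred_not (defpred_true S)).
Qed.

Lemma supported_line m P (q q' : R) : supported m.+1 P ->
  supported m (fun e => forall t : R, q < t < q' -> P (scons t e)).
Proof.
move=> sP e e' ee' Pe t tq; apply: sP (Pe t tq).
by case=> // i; apply: ee'.
Qed.

Lemma defpred_line_itv P (q q' : R) : defpred S P ->
  defpred S (fun e => forall t : R, q < t < q' -> P (scons t e)).
Proof.
move=> dP; apply: (@defpred_ext _ _ (fun e => exists x y : R, x = q /\ y = q' /\
    forall t : R, x < t < y -> P (scons t e))).
  by move=> e; split=> [[x [y [-> [->]]]]|]; last by exists q, q'.
solve_defpred.
Qed.

(* As the line is uncountable, countable covers suffice; the index of the inner
   cover grows by the rational bounds of an interval with each band. *)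
Lemma box_cell_cover m d C : box_cell m d C -> forall (I : countType) (P : I -> env -> Prop),
  (forall i, defpred S (P i)) -> (forall i, supported m (P i)) ->
  (forall e, C e -> exists i, P i e) ->
  exists i C', [/\ box_cell m d C', open_in m C C' & forall e, C' e -> C e /\ P i e].
Proof.
elim=> {m d C} [|m d A f bA IH lf dG cf|m d A a b bA IH ab] I P dP sP cov.
- have [i Pi] := cov (fun=> 0) Logic.I; exists i, (fun=> True); split=> // [|e _|e _].
  + exact: box_cell_pt.
  + by exists (fun=> 0), (fun=> 0).
  + by split=> //; apply: sP Pi.
- have sQ' i : supported m (fun e => exists t : R, graph_env A f (scons t e) /\ P i (scons t e)).
    move=> e e' ee' [t [[Ae tf] Pt]]; exists t; split.
      split; first exact: (box_cell_supported bA) Ae.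
      by rewrite /= in tf *; rewrite tf; apply: lf.
    by apply: sP Pt; case=> //= j /ee'.
  have [|||i [A' [bA' oA' A'P]]] := IH I (fun i e =>
      exists t : R, graph_env A f (scons t e) /\ P i (scons t e)).
  + by move=> i; have := dP i; move=> ?; solve_defpred.
  + exact: sQ'.
  + move=> e Ae; have [|i Pi] := cov (scons (f e) e); first by split.
    by exists i, (f e).
  exists i, (graph_env A' f).
  have dA' := box_cell_defpred bA'.
  split.
  + apply: box_cell_graph => //.
      apply: (@defpred_ext _ _ (fun e => A' (stail e) /\ graph_env A f e)); last by solve_defpred.
      by move=> e; split=> [[A'e [_ ef]]|[A'e ef]]; split=> //; split=> //; case: (A'P _ A'e).
    move=> e /[dup] A'e /A'P[Ae _] c c' /(cf _ Ae)[l [u [leu lu]]].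
    by exists l, u; split=> // y /A'P[Ay _]; exact: lu.
  + move=> e [A'e ef]; have [l [u [leu lu]]] := oA' _ A'e.
    (* On a graph the last coordinate follows from the others, so any interval around it will do. *)
    exists (scons (e 0%N - 1) l), (scons (e 0%N + 1) u); split.
      by apply/boxS; split; rewrite //= gtrBl ltrDl ltr01.
    by move=> y [Ay yf] /boxS[_ /(lu _ Ay) A'y].
  + move=> e [A'e ef]; have [Ae [t [[_ tf] Pt]]] := A'P _ A'e; split=> //.
    by move: Pt; rewrite (_ : t = e 0%N) ?scons_stail // ef.
have [|||[[i q] q'] [A' [bA' oA' A'P]]] := IH (I * rat * rat)%type (fun k e =>
    [/\ a < ratr k.1.2, ratr k.1.2 < ratr k.2 :> R & ratr k.2 < b] /\
    forall t : R, ratr k.1.2 < t < ratr k.2 -> P k.1.1 (scons t e)).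
- by move=> k; apply: defpred_and; [exact: defpred_cst|exact: defpred_line_itv].
- by move=> k e e' ee' [kab Pt]; split=> //; apply: (supported_line (sP k.1.1) ee').
- move=> e Ae; have [||i [q [q' [aq qq' q'b Pt]]]] := @itv_cover _ S I (fun i t => P i (scons t e)) _ _ _ ab.
  + by move=> i; exact: defpred_line.
  + by move=> t tab; apply: cov.
  by exists (i, q, q').
have [e0 A'e0] := box_cell_nonempty bA'.
have [_ [/= [aq qq' q'b] _]] := A'P _ A'e0.
exists i, (fun e => A' (stail e) /\ ratr q < e 0%N < ratr q'); split.
- exact: box_cell_band.
- move=> e [A'e eq]; have [l [u [leu lu]]] := oA' _ A'e.
  exists (scons (ratr q) l), (scons (ratr q') u); split; first by apply/boxS.
  by move=> y [Ay _] /boxS[yq /(lu _ Ay) A'y].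
- move=> e [/A'P[Ae [_ /= Pt]] /[dup] eq /andP[qe eq']]; split.
    by split=> //; rewrite (lt_trans aq) //= (lt_trans eq').
  by rewrite -(scons_stail e); apply: Pt.
Qed.

Lemma open_in_trans m C C' C'' : (forall e, C' e -> C e) -> (forall e, C'' e -> C' e) ->
  open_in m C C' -> open_in m C' C'' -> open_in m C C''.
Proof.
move=> CC' CC'' o o' e C''e.
have [l [u [leu lu]]] := o _ (CC'' _ C''e); have [l' [u' [leu' lu']]] := o' _ C''e.
have [l'' [u'' [le'' lu'']]] := boxI leu leu'; exists l'', u''; split=> // y Cy /lu''[b b'].
by apply: lu' => //; apply: lu.
Qed.

Lemma box_ext m l u e l' u' e' : (forall i, (i < m)%N -> l i = l' i) ->
  (forall i, (i < m)%N -> u i = u' i) -> (forall i, (i < m)%N -> e i = e' i) ->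
  box m l u e -> box m l' u' e'.
Proof. by move=> ll uu ee b i im; rewrite -ll // -uu // -ee //; apply: b. Qed.

Lemma defpred_box m F G H : reindexing F -> reindexing G -> reindexing H ->
  defpred S (fun e => box m (F e) (G e) (H e)).
Proof.
move=> rF rG rH; apply: defpred_all_lt => i.
by apply: defpred_andb; apply: defpred_lt; apply: coordinate_sel.
Qed.

(** Three blocks of [m] quantifiers: the two corners of the box and the point [y]. The first
    argument of [P] holds parameters from the outer environment. *)
Lemma defpred_near_in m C (P : env -> env -> Prop) F : supported m C ->
  (forall e, supported m (P e)) -> defpred S C ->
  defpred S (fun e => P (sdrop m e) e) -> reindexing F ->
  defpred S (fun e => near_in m C (P e) (F e)).
Proof.
move=> sC sP dC dP [s sE]; have rF : reindexing F by exists s.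
have rFd G : reindexing G -> reindexing (fun e => F (G e)).
  by move=> [s' s'E]; exists (s' \o s) => e i; rewrite sE s'E.
apply: (@defpred_exn _ _ m).
  move=> l l' e ll' [u [leu lu]]; exists u; split; first exact: box_ext leu.
  by move=> y Cy b; apply: lu Cy _; apply: box_ext b => // i im; rewrite ll'.
apply: (@defpred_exn _ _ m).
  move=> u u' e uu' [leu lu]; split; first exact: box_ext leu.
  by move=> y Cy b; apply: lu Cy _; apply: box_ext b => // i im; rewrite uu'.
apply: defpred_and.
  by apply: defpred_box; [solve_reindexing|solve_reindexing|apply: rFd; solve_reindexing].
apply: (@defpred_alln _ _ m).
  move=> y y' e yy' lu Cy' b; apply: (sP _ _ _ yy'); apply: lu.
    by apply: sC Cy' => i im; rewrite yy'.
  by apply: box_ext b => // i im; rewrite yy'.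
apply: defpred_imp => //; apply: defpred_imp.
  by apply: defpred_box; solve_reindexing.
(* The environment now starts with [y] and the two corners; the reindexing keeps [y] and skips the
   corners. *)
have := @defpred_reindex _ S _ (fun e => scat m e (sdrop m (sdrop m (sdrop m e)))) dP.
move=> /(_ _)/wrap[]; first by solve_reindexing.
apply: defpred_ext => e; rewrite sdrop_scat.
by rewrite (@supported_eq _ m _ _ e (sP _)) // => i im; rewrite scat_lt.
Qed.

Lemma supported_near_in m C P : supported m (near_in m C P).
Proof.
move=> e e' ee' [l [u [leu lu]]]; exists l, u; split=> //.
exact: box_ext leu.
Qed.

Lemma near_in_at m C P e : C e -> near_in m C P e -> P e.
Proof. by move=> Ce [l [u [leu]]]; apply. Qed.

Lemma near_in_sub m C P P' e : (forall y, C y -> P y -> P' y) ->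
  near_in m C P e -> near_in m C P' e.
Proof.
move=> PP' [l [u [leu lu]]]; exists l, u; split=> // y Cy /(lu _ Cy); exact: PP'.
Qed.

(* [f] is continuous outside the boundaries of the sets [q < f], [q] rational,
   and no cell of dimension [d] lies in such a boundary. *)
Lemma box_cell_continuous m d C f : box_cell m d C -> local_fun m f ->
  defpred S (graph_env C f) ->
  exists C', [/\ box_cell m d C', forall e, C' e -> C e & continuous_in m C' f].
Proof.
move=> bC lf dG; have sC := box_cell_supported bC; have dC := box_cell_defpred bC.
set G := graph_env C f in dG.
have GE t e : G (scons t e) <-> C e /\ t = f e by [].
have sG : supported m.+1 G.
  move=> e e' ee' [Ce ef]; split; first by apply: sC Ce => i im; apply: ee'.
  by rewrite -ee' // ef; apply: lf => i im; apply: ee'.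
have sGt (p : R -> Prop) : supported m (fun e => exists t : R, G (scons t e) /\ p t).
  move=> e e' ee' [t [Gt pt]]; exists t; split=> //.
  by apply: sG Gt; case=> // i im; apply: ee'.
pose T (q : rat) (e : env) := exists t : R, G (scons t e) /\ ratr q < t.
have dT q : defpred S (T q).
  apply: (@defpred_ext _ _ (fun e => exists c : R, c = ratr q /\
    exists t : R, G (scons t e) /\ c < t)); last by solve_defpred.
  by move=> e; split=> [[_ [-> //]]|Te]; exists (ratr q).
have sT q : supported m (T q) by exact: sGt.
have dN q : defpred S (fun e => ~ T q e) by exact: defpred_not.
have sN q : supported m (fun e => ~ T q e).
  by move=> e e' ee'; rewrite (supported_eq (sT q) ee').
have TE q e : C e -> T q e <-> ratr q < f e.
  by move=> Ce; split=> [[t [[_ /= <-]]]|qf] //; exists (f e).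
(* [K] is continuity at [e], written through the graph [G]. The countable cover [D] consists of [K]
   and, for each rational [q], the boundary of [T q] relative to [C]. *)
pose K (e : env) := forall a b : R, (exists t : R, G (scons t e) /\ a < t < b) ->
   near_in m C (fun y => exists t : R, G (scons t y) /\ a < t < b) e.
pose D (k : option rat) (e : env) : Prop := if k is Some q then
  C e /\ ~ near_in m C (T q) e /\ ~ near_in m C (fun y => ~ T q y) e else K e.
have dD k : defpred S (D k).
  case: k => [q|]; rewrite /D.
    apply: defpred_and => //; apply: defpred_and; apply: defpred_not.
      apply: (@defpred_near_in m C (fun=> T q) (fun e => e)) => //; solve_reindexing.
    by apply: (@defpred_near_in m C (fun _ y => ~ T q y) (fun e => e)) => //; solve_reindexing.
  apply: defpred_all; apply: defpred_all; apply: defpred_imp; first by solve_defpred.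
  apply: (@defpred_near_in m C (fun e y => exists t : R, G (scons t y) /\
    stail e 0%N < t < e 0%N)) => //; last by solve_reindexing.
  by solve_defpred.
have sD k : supported m (D k).
  case: k => [q|] e e' ee'; rewrite /D.
    by rewrite (supported_eq sC ee') (supported_eq (@supported_near_in m C _) ee')
      (supported_eq (@supported_near_in m C _) ee').
  move=> Ke a b; rewrite -(supported_eq (@supported_near_in m C _) ee').
  by rewrite -(supported_eq (sGt (fun t => a < t < b)) ee'); apply: Ke.
have [e Ce|k [C' [bC' oC' C'P]]] := box_cell_cover bC dD sD.
  have [[q Dq]|/forallNP nD] := pselect (exists q, D (Some q) e); first by exists (Some q).
  exists None => a b [t [/GE[_ ->] /andP[af fb]]].
  have [q /andP[aq qf]] := rat_between af; have [q' /andP[fq' q'b]] := rat_between fb.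
  have n1 : near_in m C (T q) e.
    apply: contrapT => nT; apply: (nD q); split=> //; split=> // /(near_in_at Ce); apply.
    exact/(TE _ _ Ce).
  have n2 : near_in m C (fun y => ~ T q' y) e.
    apply: contrapT => nT; apply: (nD q'); split=> //; split=> // /(near_in_at Ce).
    by move=> /(TE _ _ Ce); rewrite ltNge (ltW fq').
  case: n1 n2 => l [u [leu lu]] [l' [u' [leu' lu']]].
  have [l'' [u'' [leu'' lu'']]] := boxI leu leu'; exists l'', u''; split=> // y Cy.
  move=> /lu''[/(lu _ Cy)/(TE _ _ Cy) qy /(lu' _ Cy) nT]; exists (f y); split=> //.
  rewrite (lt_trans aq qy) /=; apply: le_lt_trans q'b; rewrite leNgt.
  by apply/negP => /(TE _ _ Cy).
case: k C'P => [q|] C'P; last first.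
  exists C'; split=> // [e /C'P[]//|e /C'P[Ce Ke] a b fab].
  have [|l [u [leu lu]]] := Ke a b; first by exists (f e).
  exists l, u; split=> // y /C'P[Cy _] /(lu _ Cy)[t [/GE[_ ->]]].
  by [].
(* If [C'] lay in the boundary of [T q], a smaller cell, still relatively open in [C], would lie in
   [T q] or in its complement, so its points would not be boundary points. *)
have [b|b|e C'e|b [C'' [bC'' oC'' C''P]]] := @box_cell_cover m d C' bC' bool
    (fun b e => if b then T q e else ~ T q e).
- by case: b.
- by case: b.
- by have [Te|nTe] := pselect (T q e); [exists true|exists false].
have [e C''e] := box_cell_nonempty bC''.
have [C'e _] := C''P _ C''e; have [Ce [_ [n1 n2]]] := C'P _ C'e.
have : near_in m C C'' e.
  by apply: open_in_trans oC' oC'' _ C''e => y; [move=> /C'P[]|move=> /C''P[]].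
case: b C''P => C''P ne; exfalso; [apply: n1|apply: n2].
  by apply: near_in_sub ne => y _ /C''P[].
by apply: near_in_sub ne => y _ /C''P[].
Qed.

End BoxCells.

(** * The exponent of the type count is attained by a cell *)

Section TameSets.
Context {R : realType} (S : ominStructure R).
Local Notation env := (env R).
Implicit Types (P X A C : env -> Prop).

Definition contains_cell m d X :=
  exists2 C, box_cell S m d C & forall e, C e -> X e.

(** The same [d] occurs twice: as the exponent bounding the types and as the dimension of a cell
    inside [X]. The empty set, which contains no cell, is kept apart. *)
Definition tame m X :=
  (forall e, ~ X e) \/ exists d, types_le S d m X /\ contains_cell m d X.

Lemma tameU m X X' : tame m X -> tame m X' -> tame m (fun e => X e \/ X' e).
Proof.
move=> [nX|[d [tX [C bC CX]]]].
  move=> [nX'|[d [tX [C bC CX]]]]; first by left=> e [/nX|/nX'].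
  right; exists d; split; last by exists C => // e /CX; right.
  move=> P /tX[K PK]; exists K => B /PK[L sL XL]; exists L => // x [/nX//|].
  exact: XL.
move=> [nX'|[d' [tX' [C' bC' CX']]]].
  right; exists d; split; last by exists C => // e /CX; left.
  move=> P /tX[K PK]; exists K => B /PK[L sL XL]; exists L => // x [|/nX'//].
  exact: XL.
right; exists (maxn d d'); split.
  by apply: types_leU; [apply: types_le_leq tX|apply: types_le_leq tX'];
    rewrite ?leq_maxl ?leq_maxr.
have [_|_] := leqP d d'; first by exists C' => // e /CX'; right.
by exists C => // e /CX; left.
Qed.

Lemma tame_ext m X X' : (forall e, X e <-> X' e) -> tame m X -> tame m X'.
Proof. by move=> XX'; have -> : X = X' by apply/funext => e; apply/propext. Qed.

Lemma tame_ex_lt m n (X : nat -> env -> Prop) : (forall j, tame m (X j)) ->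
  tame m (fun e => exists2 j, (j < n)%N & X j e).
Proof.
move=> tX; elim: n => [|n IH]; first by left=> e [].
apply: tame_ext (tameU IH (tX n)) => e; split=> [[[j jn Xj]|Xn]|[j]].
- by exists j => //; apply: leqW.
- by exists n.
- by rewrite ltnS leq_eqVlt => /predU1P[->|jn Xj]; [right|left; exists j].
Qed.

(** A function raises neither number: types are counted by [types_le_graph], and over a smaller cell
    of the same dimension the function is continuous, so that its graph there is a cell. *)
Lemma tame_graph m A X : tame m A -> defpred S X -> supported m.+1 X ->
  (forall e, A e <-> exists t : R, X (scons t e)) ->
  (forall t e, X e -> X (scons t (stail e)) -> t = e 0%N) -> tame m.+1 X.
Proof.
move=> [nA|[d [tA [C bC CA]]]] dX sX AX Xinj.
  by left=> e Xe; apply: (nA (stail e)); apply/AX; exists (e 0%N); rewrite scons_stail.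
right; exists d; split.
  apply: (types_le_graph tA dX sX) => // e Xe; split=> //.
  by apply/AX; exists (e 0%N); rewrite scons_stail.
(* The default value 0 is taken only outside [A], while the cells below lie inside [A]. *)
pose f (e : env) : R := xget 0 (fun t => X (scons t e)).
have fX e : A e -> X (scons (f e) e).
  by move=> /AX[t Xt]; apply: (@xgetPex _ 0 (fun t => X (scons t e))); exists t.
have lf : local_fun m f.
  move=> e e' ee'; congr (xget _ _); apply/funext => t; apply: (supported_eq sX).
  by case=> // i /ee'.
have GE A' : (forall e, A' e -> A e) -> forall e, graph_env A' f e <-> A' (stail e) /\ X e.
  move=> A'A e; split=> -[A'e]; rewrite /graph_env.
    move=> ef; split=> //; rewrite -(scons_stail e) ef; exact/fX/A'A.
  by move=> Xe; split=> //; apply/esym/Xinj => //; exact/fX/A'A.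
have [C' [bC' C'C cC']] : exists C', [/\ box_cell S m d C', forall e, C' e -> C e &
    continuous_in m C' f].
  apply: box_cell_continuous => //; have dC := box_cell_defpred bC.
  apply: (@defpred_ext _ _ (fun e => C (stail e) /\ X e)); last by solve_defpred.
  by move=> e; rewrite GE.
have dC' := box_cell_defpred bC'.
exists (graph_env C' f); last by move=> e /GE[e' /C'C/CA //|].
apply: box_cell_graph => //.
apply: (@defpred_ext _ _ (fun e => C' (stail e) /\ X e)); last by solve_defpred.
by move=> e; rewrite GE // => e' /C'C/CA.
Qed.

(** Both numbers rise by one. For the cell, the intervals in the fibres are shrunk to rational
    bounds; countably many choices cover the base cell, so one choice works over a smaller cell. *)
Lemma tame_band m A X : tame m A -> defpred S X -> supported m.+1 X ->
  (forall e, X e -> A (stail e)) ->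
  (forall e, A e -> exists a b : R, a < b /\ forall t, a < t < b -> X (scons t e)) ->
  tame m.+1 X.
Proof.
move=> [nA|[d [tA [C bC CA]]]] dX sX XA AX; first by left=> e /XA/nA.
right; exists d.+1; split; first exact: types_le_band tA XA.
have [k|k|e /CA/AX[a [b [ab abX]]]|[q q'] [C' [bC' _ C'P]]] := @box_cell_cover _ S _ _ _ bC
    (rat * rat)%type (fun k e => (ratr k.1 < ratr k.2 :> R) /\
    forall t : R, ratr k.1 < t < ratr k.2 -> X (scons t e)).
- by apply: defpred_and; [exact: defpred_cst|exact: defpred_line_itv].
- by move=> e e' ee' [kab Xt]; split=> //; apply: (supported_line sX ee').
- have [q /andP[aq qb]] := rat_between ab; have [q' /andP[qq' q'b]] := rat_between qb.
  by exists (q, q'); split=> //= t /andP[qt tq']; apply: abX;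
    rewrite (lt_trans aq) ?(lt_trans tq').
have [e0 C'e0] := box_cell_nonempty bC'; have [_ [/= qq' _]] := C'P _ C'e0.
exists (fun e => C' (stail e) /\ ratr q < e 0%N < ratr q'); first exact: box_cell_band.
by move=> e [/C'P[_ [_ Xt]] /Xt]; rewrite scons_stail.
Qed.

(** Induction on [m]. The points interior to their fibre form a band-like part; the others form
    finitely many graphs, one for each index of a boundary point, by uniform finiteness. *)
Theorem defpred_tame m X : defpred S X -> supported m X -> tame m X.
Proof.
elim: m X => [|m IH] X dX sX.
  have [X0|nX0] := pselect (X (fun=> 0)); last by left=> e Xe; apply: nX0; apply: sX Xe.
  right; exists 0%N; split; first exact: types_le0.
  by exists (fun=> True) => [|e _]; [exact: box_cell_pt|exact: sX X0].
have [N XN] := fiber_boundary_card dX; have dB := defpred_boundary dX.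
have IH' Y : defpred S Y -> supported m.+1 Y -> tame m (fun e => exists t : R, Y (scons t e)).
  move=> dY sY; apply: IH; first by solve_defpred.
  by move=> e e' ee' [t Yt]; exists t; apply: sY Yt; case=> // i /ee'.
have sB e e' : (forall i, (i < m.+1)%N -> e i = e' i) ->
    fiber_boundary X (stail e) = fiber_boundary X (stail e').
  by move=> ee'; apply: (fiber_boundary_supp sX) => i im; apply: ee'.
pose Xi (e : env) := X e /\ ~ fiber_boundary X (stail e) (e 0%N).
pose Xb j (e : env) := X e /\ nth_point (fiber_boundary X (stail e)) j (e 0%N).
have dXi : defpred S Xi by rewrite /Xi; solve_defpred.
have sXi : supported m.+1 Xi.
  by move=> e e' ee' [Xe nb]; split; [exact: sX Xe|rewrite -(sB _ _ ee') -ee'].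
have tXi : tame m.+1 Xi.
  apply: (tame_band (IH' _ dXi sXi) dXi sXi) => e.
    by move=> Xe; exists (e 0%N); rewrite scons_stail.
  move=> [t [Xt /boundaryPn[a [b [tab Xab]]]]]; exists a, b; split.
    by case/andP: tab; apply: lt_trans.
  move=> u uab; split; first exact/(Xab _ uab).
  move=> /(_ a b uab)[_ [v [vab]]]; apply; exact/(Xab _ vab).
have tXb j : tame m.+1 (Xb j).
  have dXb : defpred S (Xb j).
    by apply: defpred_and => //; apply: defpred_boundary_point => //; solve_reindexing.
  have sXb : supported m.+1 (Xb j).
    by move=> e e' ee' [Xe nb]; split; [exact: sX Xe|rewrite -(sB _ _ ee') -ee'].
  apply: (tame_graph (IH' _ dXb sXb) dXb sXb) => //.
  by move=> t e [_ ej] [_ tj]; apply: nth_point_inj tj ej.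
apply: tame_ext (tameU tXi (tame_ex_lt N tXb)) => e; split=> [[[]|[j _ []]]|Xe] //.
have [be|nbe] := pselect (fiber_boundary X (stail e) (e 0%N)); last by left.
by right; have [j jN ej] := nth_point_exists (XN _) be; exists j.
Qed.

End TameSets.

(** * Comparison with cells and with [odim] *)

Section CellsOfBoxCells.
Context {R : realType} (S : ominStructure R).
Local Notation env := (env R).

Lemma nbhs_box m l u (x : 'rV[R]_m) : box m l u (env_of x) ->
  \forall y \near x, box m l u (env_of y).
Proof.
move=> bx; exists (fun _ j => [set t : R | l (rev_ord j) < t < u (rev_ord j)]).
  move=> i j; rewrite (ord1 i); have := bx (rev_ord j) (ltn_ord _).
  rewrite env_of_ord rev_ordK => lxu.
  by have := @near_in_itvoo R (l (rev_ord j)) (u (rev_ord j)) (x 0 j); apply; rewrite in_itv.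
move=> y /= yP i im; rewrite -[i]/(nat_of_ord (Ordinal im)) env_of_ord.
have : l (rev_ord (rev_ord (Ordinal im))) < y 0 (rev_ord (Ordinal im)) <
  u (rev_ord (rev_ord (Ordinal im))) by exact: yP.
by rewrite rev_ordK.
Qed.

Lemma continuous_in_within m (A : env -> Prop) f : continuous_in m A f ->
  {within [set x : 'rV[R]_m | A (env_of x)], continuous (fun x => f (env_of x))}.
Proof.
move=> cf; apply/subspace_continuousP => x Ax; apply/cvgrPdist_lt => eps eps0.
have [|l [u [bx lu]]] := cf _ Ax (f (env_of x) - eps) (f (env_of x) + eps).
  by rewrite gtrBl ltrDl eps0.
rewrite near_withinE; apply: filterS (nbhs_box bx) => y by_ Ay.
by rewrite ltr_distlC; apply: lu.
Qed.

Lemma box_cell_cell m d C : box_cell S m d C ->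
  cell S d [set x : 'rV[R]_m | C (env_of x)].
Proof.
have graphE n (A : env -> Prop) f :
    [set x : 'rV[R]_n.+1 | graph_env A f (env_of x)] =
    graph_on [set x | A (env_of x)] (fun x => f (env_of x)).
  by apply/funext => x; rewrite /graph_env /graph_on /= stail_env_of env_of0.
elim=> {m d C} [|m d A f bA IH lf dG cf|m d A a b bA IH ab].
- exact: cell_pt.
- rewrite graphE; apply: cell_graph => //; split; last exact: continuous_in_within.
  rewrite -graphE; apply: (defpred_at dG).
  exact: box_cell_supported (box_cell_graph bA lf dG cf).
have cst_fun c : cell_fun S [set x : 'rV[R]_m | A (env_of x)] (fun=> c).
  split; last by apply: continuous_subspaceT; exact: cst_continuous.
  have dA := box_cell_defpred bA.
  have dG : defpred S (graph_env A (fun=> c)) by rewrite /graph_env; solve_defpred.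
  rewrite -graphE; apply: (defpred_at dG) => e e' ee' [Ae ec]; split.
    by apply: (box_cell_supported bA) Ae => i im; apply: ee'.
  by rewrite -ee'.
rewrite (_ : [set x | _] = band_on [set x | A (env_of x)] (EFin \o (fun=> a)) (EFin \o (fun=> b))).
  apply: cell_band => //=; [apply: Or33; exists (fun=> a)|apply: Or33; exists (fun=> b)];
    by [exact: cst_fun|].
by apply/funext => x; rewrite /band_on /= stail_env_of env_of0 !lte_fin.
Qed.

Lemma box_cell_dim m d C : box_cell S m d C -> (d <= m)%N.
Proof. by elim=> // *; apply: leqW. Qed.

Lemma contains_cell_odim m d (X : set 'rV[R]_m) :
  contains_cell S m d (fun e => X (row_of m e)) -> (d <= odim S X)%N.
Proof.
move=> [C bC CX]; have dm : (d < m.+1)%N by rewrite ltnS (box_cell_dim bC).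
rewrite /odim (@leq_bigmax_cond _ _ (fun d : 'I_m.+1 => nat_of_ord d) (Ordinal dm)) //.
apply/asboolP; exists [set x : 'rV[R]_m | C (env_of x)]; first exact: box_cell_cell.
by move=> x /= /CX; rewrite env_ofK.
Qed.

Lemma types_le_odim m (X : set 'rV[R]_m) : definable S X ->
  types_le S (odim S X) m (fun e => X (row_of m e)).
Proof.
move=> dX; have [X0|[d [tX cX]]] := defpred_tame (defpred_row_of dX) (@supported_row_of _ m X).
  by move=> P _; exists 0%N => B _; exists [::] => // x /X0.
exact: types_le_leq (contains_cell_odim cX) tX.
Qed.

End CellsOfBoxCells.

(** * Atoms of a finite family of relatively closed sets *)

Section Atoms.
Context {R : realType} (S : ominStructure R) (m : nat) (X : set 'rV[R]_m).

Lemma continuous_row_mx k (w : 'rV[R]_k) :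
  continuous (fun x : 'rV[R]_m => row_mx x w : 'rV[R]_(m + k)).
Proof.
move=> x A [P xP PA]; exists (fun i j => P i (lshift k j)).
  by move=> i j; have := xP i (lshift k j); rewrite row_mxEl.
move=> y yP; apply: PA => i j; rewrite mxE; case: (split_ordP j) => j' jE.
  by rewrite jE; exact: yP.
by have := nbhs_singleton (xP i j); rewrite jE row_mxEr.
Qed.

Definition relatively_closed (F : set 'rV[R]_m) := exists2 V, closed V & X `&` F = X `&` V.

(** By induction on [s]: a condition with value true shrinks the closed factor, one with value false
    shrinks the open factor. *)
Lemma atom_locally_closed (T : eqType) (F : T -> set 'rV[R]_m) (s : seq T) (c : T -> bool) :
  definable S X ->
  (forall a, a \in s -> definable S (F a) /\ relatively_closed (F a)) ->
  let A := [set y | X y /\ forall a, a \in s -> `[< F a y >] = c a] in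
  definable S A /\ locally_closed_in X A.
Proof.
move=> dX; elim: s => [|a s IH] sF A.
  rewrite (_ : A = X); last by apply/seteqP; split=> y //= [].
  split=> //; split=> //; exists setT, X; split; last by rewrite setTI.
    exact: openT.
  by apply/closed_subspaceP; exists setT; rewrite ?setTI ?setIid //; exact: closedT.
have [|dA' [_ [U [V [oU cV A'E]]]]] := IH.
  by move=> b bs; apply: sF; rewrite in_cons bs orbT.
set A' := [set y | _] in dA' A'E.
have [dF [W cW FW]] := sF a (mem_head _ _).
have AE : A = A' `&` (if c a then F a else ~` F a).
  apply/seteqP; split=> y.
    move=> [Xy ys]; split; first by split=> // b bs; apply: ys; rewrite in_cons bs orbT.
    by have := ys a (mem_head _ _); case: (c a) => /asboolP.
  move=> [[Xy ys] ya]; split=> // b; rewrite in_cons => /predU1P[->|/ys//].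
  by case: (c a) ya => ya; [apply/asboolP|apply/asboolPn].
have definableI (B B' : set 'rV[R]_m) : definable S B -> definable S B' -> definable S (B `&` B').
  move=> dB dB'; rewrite -(setCK (B `&` B')) setCI.
  by apply/definableC/definableU; apply: definableC.
split.
  by rewrite AE; apply: definableI => //; case: (c a) => //; apply: definableC.
split; first by move=> y [].
have FX y : X y -> F a y <-> W y.
  move=> Xy; have := congr1 (fun B : set 'rV[R]_m => B y) FW.
  by rewrite /= => FWy; split=> ?; [have [] : X y /\ W y by rewrite -FWy|
    have [] : X y /\ F a y by rewrite FWy].
have A'X y : A' y -> X y by case.
have cW' : closed (W : set (subspace X)) by apply: closed_subspaceW.
case: (c a) AE => AE.
  exists U, (V `&` W); split=> //; first exact: closedI.
  rewrite setIA -A'E AE; apply/seteqP.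
  by split=> y [A'y ya]; split=> //; apply/(FX _ (A'X _ A'y)).
exists (U `&` ~` W), V; split=> //; first by apply: openI => //; apply: closed_openC.
rewrite setIAC -A'E AE; apply/seteqP.
by split=> y [A'y ya]; split=> //= /(FX _ (A'X _ A'y)).
Qed.

End Atoms.

(** * All the filtrations as one definable family *)

Section Families.
Context {R : realType} (S : ominStructure R) (m k : nat).
Local Notation env := (env R).
Variable Y : forall i : nat, nat -> set 'rV[R]_(m + i * k).

(* The sets [Y i j] form a single family: the head of an environment of
   parameters is the code of (i, j), its tail holds the coordinates of w. *)
Definition param (a : nat * nat) (w : 'M[R]_(a.1, k)) : env :=
  scons (choice.pickle a)%:R (env_of (mxvec w)).

Definition indexed_set (a : nat * nat) (e : env) : Prop :=
  @Y a.1 a.2 (\row_l match fintype.split l : 'I_m + 'I_(a.1 * k) with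
                | inl l1 => e (rev_ord l1)
                | inr l2 => e (m + (rev_ord l2).+1)%N
                end).

(** The disjunction over tags makes one formula of all the sets, so that a single type records
    membership in every fibre. *)
Definition tagged_family (s : seq (nat * nat)) (e : env) : Prop :=
  exists2 a, a \in s & e m = (choice.pickle a)%:R /\ indexed_set a e.

Lemma indexed_setE a (x : 'rV[R]_m) (w : 'M[R]_(a.1, k)) :
  indexed_set a (scat m (env_of x) (param w)) <-> @Y a.1 a.2 (pairpt x w).
Proof.
rewrite /indexed_set (_ : \row__ _ = pairpt x w) //; apply/rowP => l.
rewrite !mxE; case: fintype.split => j; first by rewrite (scat_lt _ _ (ltn_ord _)) env_of_ord rev_ordK.
rewrite /scat ltnNge leq_addr addKn -[LHS]/(env_of (mxvec w) (rev_ord j)).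
by rewrite env_of_ord rev_ordK.
Qed.

Lemma tagged_familyE s a (x : 'rV[R]_m) (w : 'M[R]_(a.1, k)) : a \in s ->
  tagged_family s (scat m (env_of x) (param w)) <-> @Y a.1 a.2 (pairpt x w).
Proof.
move=> as_; rewrite -indexed_setE; split=> [[a' _ [am]]|Ya].
  suff -> : a' = a by [].
  move: am; rewrite /scat ltnn subnn /= => /eqP; rewrite eqr_nat => /eqP.
  by move/(pcan_inj choice.pickleK).
by exists a => //; split=> //; rewrite /scat ltnn subnn.
Qed.

Lemma defpred_tagged_family s : (forall a, a \in s -> definable S (@Y a.1 a.2)) ->
  defpred S (tagged_family s).
Proof.
move=> dY; apply: defpred_ex_seq => a /dY dYa; apply: defpred_and.
  by apply: defpred_eqc; exists m.
apply: (@defpred_atom _ S _ (@Y a.1 a.2) (fun l e => match fintype.split l : 'I_m + 'I_(a.1 * k) with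
  | inl l1 => e (rev_ord l1) | inr l2 => e (m + (rev_ord l2).+1)%N end) dYa).
by move=> l; case: fintype.split => j; eexists.
Qed.

(** All maps [J] are listed, injective or not: further parameters only refine the atoms, and the
    count is a plain power of [n.+1]. *)
Definition params n (z : 'M[R]_(n.+1, k)) (s : seq (nat * nat)) : seq env :=
  flatten [seq [seq param (rowsub J z) | J : {ffun 'I_a.1 -> 'I_n.+1}] | a <- s].

Lemma mem_params n (z : 'M[R]_(n.+1, k)) s b : b \in params z s <->
  exists a (J : {ffun 'I_a.1 -> 'I_n.+1}), a \in s /\ b = param (rowsub J z).
Proof.
split=> [/flattenP[_ /mapP[a as_ ->] /mapP[J _ ->]]|[a [J [as_ ->]]]]; first by exists a, J.
apply/flattenP; eexists; first by apply/mapP; exists a.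
by apply/mapP; exists J; rewrite ?mem_enum.
Qed.

Lemma size_params n (z : 'M[R]_(n.+1, k)) s p : (forall a, a \in s -> (a.1 <= p)%N) ->
  (size (params z s) <= size s * n.+1 ^ p)%N.
Proof.
move=> sp; apply: size_flatten_le => a /sp ap.
by rewrite size_map -cardE card_ffun !card_ord leq_pexp2l.
Qed.

Lemma fiber_relatively_closed (X : set 'rV[R]_m) (Z : set 'rV[R]_k) i
    (Yi : set 'rV[R]_(m + i * k)) (w : 'M[R]_(i, k)) : setpow Z w ->
  closed_in (prodpow X Z i) Yi -> relatively_closed X [set x | Yi (pairpt x w)].
Proof.
move=> Zw [YX /closed_subspaceP[V cV VY]].
exists ((fun x => pairpt x w) @^-1` V).
  by apply: closed_comp cV => x _; exact: continuous_row_mx.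
apply/seteqP; split=> x [Xx xY]; split=> //.
  have : (Yi `&` prodpow X Z i) (pairpt x w) by split=> //; apply: YX.
  by rewrite -VY => -[].
have : (V `&` prodpow X Z i) (pairpt x w) by split=> //; exists x, w.
by rewrite VY => -[].
Qed.

End Families.

(** * The stratification into atoms *)

Theorem theorem3p7 (R : realType) (S : ominStructure R) (m k p : nat)
    (X : set 'rV[R]_m) (Z : set 'rV[R]_k)
    (r : nat -> nat) (Y : forall i : nat, nat -> set 'rV[R]_(m + i * k))
    (p_ge1 : (1 <= p)%N)
    (defX : definable S X) (defZ : definable S Z)
    (Y0 : forall i, (1 <= i <= p.+1)%N -> Y i 0%N = prodpow X Z i)
    (Ydec : forall i j, (1 <= i <= p.+1)%N -> (j < r i)%N ->
      Y i j.+1 `<=` Y i j)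
    (Ydef : forall i j, (1 <= i <= p.+1)%N -> (j <= r i)%N ->
      definable S (Y i j))
    (Yclosed : forall i j, (1 <= i <= p.+1)%N -> (j <= r i)%N ->
      closed_in (prodpow X Z i) (Y i j)) :
  exists2 C : R, 0 < C &
    forall (n : nat) (z : 'M[R]_(n.+1, k)), (0 < n)%N -> setpow Z z ->
    exists P : set (set 'rV[R]_m),
      [/\ stratification S X P,
          (strat_length P)%:R <= C * n.+1%:R ^+ (p.+1 * odim S X) &
          forall (i : nat) (J : 'I_i -> 'I_n.+1),
            (1 <= i <= p)%N -> injective J ->
            strat_refines P
              (filtration_strata (r i)
                 (fun j => fiber X (Y i j) (rowsub J z)))].
Proof.
pose s := [seq (i, j) | i <- iota 1 p, j <- iota 0 (r i).+1].
have sP i j : (i, j) \in s <-> (1 <= i <= p)%N /\ (j <= r i)%N.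
  split=> [/allpairsPdep[i' [j' []]]|[ip jr]].
    by rewrite !mem_iota => i'p j'r [-> ->]; lia.
  by apply/allpairsPdep; exists i, j; rewrite !mem_iota; split=> //; lia.
have sp a : a \in s -> (1 <= a.1 <= p.+1)%N /\ (a.2 <= r a.1)%N.
  by case: a => i j /sP[/andP[i1 ip] jr]; rewrite /= i1 jr (leqW ip).
have dF := @defpred_tagged_family _ S m k Y s (fun a as_ => Ydef _ _ (sp a as_).1 (sp a as_).2).
have [K FK] := types_le_odim defX dF.
set d := odim S X in FK *.
(* The constant collects [K] from the type count and [size s] for the number of pairs (i, j); the
   successor makes it positive. *)
exists (K * size s ^ d).+1%:R; first by rewrite ltr0n.
move=> n z n0 Zz; set B := params z s.
(* As [p] is at least 1, the pair (1, 0) lies in [s] and provides a parameter. *)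
have B0 : (0 < size B)%N.
  have : param (a := (1%N, 0%N)) (rowsub [ffun=> ord0] z) \in B.
    by apply/mem_params; exists (1%N, 0%N), [ffun=> ord0]; split=> //; apply/sP; lia.
  by case: B.
have [L sL XL] := FK B B0.
pose ty (x : 'rV[R]_m) := type_of (tagged_family Y s) m B (env_of x).
have XLx x : X x -> ty x \in L by move=> Xx; apply: XL; rewrite env_ofK.
have tyE x y : ty y = ty x <-> forall b, b \in B ->
    `[< tagged_family Y s (scat m (env_of y) b) >] = `[< tagged_family Y s (scat m (env_of x) b) >].
  exact: iff_sym (eq_in_map _ _ _).
pose atom l := [set y | X y /\ ty y = l].
(* Atoms are indexed by points of [X] rather than by lists in [L], so that no part is empty. *)
pose P := [set A | exists2 x, X x & A = atom (ty x)].
have PL A : P A -> A \in [seq atom l | l <- L].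
  by move=> [x Xx ->]; apply: map_f; apply: XLx.
have finP : finite_set P by apply: sub_finite_set (finite_seq [seq atom l | l <- L]).
exists P; split.
- split=> //.
    split.
    + apply/seteqP; split=> [x [A [y Xy ->] []] //|x Xx].
      by exists (atom (ty x)) => //; exists x.
    + move=> A A' [x Xx ->] [x' Xx' ->] [y [[Xy yx] [_ yx']]].
      by rewrite /id -yx -yx'.
    + by move=> A [x Xx ->]; exists x.
  move=> A [x Xx ->].
  have -> : atom (ty x) = [set y | X y /\ forall b, b \in B ->
      `[< tagged_family Y s (scat m (env_of y) b) >] = `[< tagged_family Y s (scat m (env_of x) b) >]].
    by apply/seteqP; split=> y [Xy /tyE].
  apply: (@atom_locally_closed _ _ _ _ _ (fun b => [set y | tagged_family Y s (scat m (env_of y) b)])) => //.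
  move=> b /mem_params[a [J [as_ ->]]]; split.
    apply: defpred_at (defpred_fix m _ dF) _ => e e' ee'.
    by rewrite (scat_eqx _ ee').
  rewrite (_ : [set y | _] = [set y | Y a.1 a.2 (pairpt y (rowsub J z))]); last first.
    by apply/seteqP; split=> y /= /tagged_familyE; apply.
  have [ai aj] := sp a as_.
  apply: fiber_relatively_closed (Yclosed _ _ ai aj) => j.
  by rewrite row_rowsub; exact: Zz.
(* There are at most [size s * n.+1 ^ p] parameters, hence the exponent [p * d], which is at most
   [p.+1 * d]. *)
- have : (strat_length P <= K * size s ^ d * n.+1 ^ (p.+1 * d))%N.
    apply: (@leq_trans (size L)).
      rewrite -(size_map atom); apply: uniq_leq_size; first exact: fset_uniq.
      by move=> A; rewrite in_fset_set // inE; exact: PL.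
    apply: leq_trans sL _; rewrite -mulnA leq_mul2l; apply/orP; right.
    apply: (@leq_trans ((size s * n.+1 ^ p) ^ d)%N).
      have [->|d0] := posnP d; first by rewrite !expn0.
      by rewrite leq_exp2r // size_params // => -[i j] /sP[/andP[]].
    by rewrite expnMn leq_mul2l -expnM leq_pexp2l ?orbT // leq_mul2r leqnSn orbT.
  move=> le; rewrite -natrX -natrM ler_nat; apply: leq_trans le _.
  by rewrite leq_mul2r leqnSn orbT.
move=> i J ip _ A [_ AE].
(* The type of a point decides its membership in every fibre, so each stratum of the filtration is a
   union of atoms. *)
have sat x y : X x -> X y -> ty y = ty x -> A x -> A y.
  move=> Xx Xy /tyE xy.
  have Fxy j : (j <= r i)%N -> fiber X (Y i j) (rowsub J z) x <-> fiber X (Y i j) (rowsub J z) y.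
    move=> jr; have ijs : (i, j) \in s by apply/sP.
    have : param (a := (i, j)) (rowsub (finfun J) z) \in B.
      by apply/mem_params; exists (i, j), (finfun J).
    move=> /xy xyB; have xyE := asbool_eq_equiv xyB.
    have wE : rowsub (finfun J) z = rowsub J z by apply/matrixP => u v; rewrite !mxE ffunE.
    rewrite wE in xyE; have YE t : _ <-> Y i j (pairpt t (rowsub J z)) :=
      tagged_familyE Y t (rowsub J z : 'M_((i, j).1, k)) ijs.
    by split=> -[_ /YE/xyE/YE ?]; split.
  case: AE => [[j jr ->]|->]; last by move/Fxy; apply.
  by move=> [Fx nFx]; split; [apply/Fxy; rewrite // ltnW|move/Fxy => /(_ jr)].
have AX : A `<=` X.
  by case: AE => [[j _ ->] x [[]]|-> x []].
exists [set A' | P A' /\ A' `<=` A]; first by move=> A' [].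
apply/seteqP; split=> [x Ax|x [A' [_ A'A]]]; last exact: A'A.
exists (atom (ty x)); last by split=> //; exact: AX.
split; first by exists x => //; exact: AX.
by move=> y [Xy yx]; exact: sat (AX _ Ax) Xy yx Ax.
Qed.
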